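(* Let $\gamma,L>0$. Assume that in the model $Y_{i,j}=\mu(x_j)+Z_i(x_j)+\epsilon_{i,j}$, $1\le i\le n$, $1\le j\le p$, the errors $\epsilon_{i,j}$ are i.i.d. $\mathcal N(0,\sigma_0^2)$-distributed with $\sigma_0^2>0$. Set $$a_{n,p}=\max\Big(p^{-\gamma},\ \Big(\frac{\log(np)}{np}\Big)^{\frac{\gamma}{2\gamma+1}},\ n^{-1/2}\Big).$$ Then $$\liminf_{n,p\to\infty}\ \inf_{\hat G_{n,p}}\ \sup_{Z\in\mathcal P_{\mathcal G}(\gamma;L)} a_{n,p}^{-1}\,\mathbb E\big[\|\hat G_{n,p}-\Gamma\|_\infty\big]>0,$$ where the infimum is taken over all estimators $\hat G_{n,p}$ of $\Gamma$.
   Context: Model. $Y_{i,j}=\mu(x_j)+Z_i(x_j)+\epsilon_{i,j}$ with known non-random design points $x_1<\dots<x_p$ in $[0,1]$ (which may depend on $n,p$), mean function $\mu:[0,1]\to\mathbb R$, and $Z_1,\dots,Z_n$ i.i.d. copies of a centered square-integrable process $Z$ on $[0,1]$ with covariance kernel $\Gamma(x,y)=\mathbb E[Z(x)Z(y)]$; the errors are independent of the $Z_i$. An estimator $\hat G_{n,p}$ is a measurable function of the data $(Y_{i,j})_{i\le n,j\le p}$ (and of the design points) with values in functions on $[0,1]^2$. $\|\cdot\|_\infty$ is the supremum norm on $[0,1]^2$. Let $T=\{(x,y)\in[0,1]^2:x\le y\}$ and $\lfloor\gamma\rfloor:=\max\{k\in\mathbb N_0:k<\gamma\}$ (strict inequality).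 With $k=\lfloor\gamma\rfloor$, $\|f\|_{\mathcal H,\gamma;T}=\max_{|s|\le k}\sup_{v\in T}|D^sf(v)|+\max_{|s|=k}\sup_{v\ne w\in T}\frac{|D^sf(v)-D^sf(w)|}{\|v-w\|_\infty^{\gamma-k}}$, $s\in\mathbb N_0^2$, and $\mathcal H_T(\gamma,L)=\{f:T\to\mathbb R:\|f\|_{\mathcal H,\gamma;T}\le L\}$ (partial derivatives of order $\le k$ required to exist). $\mathcal P_{\mathcal G}(\gamma;L)$ is the set of centered Gaussian processes on $[0,1]$ whose covariance kernel satisfies $\Gamma|_T\in\mathcal H_T(\gamma,L)$. *)

(* Defs.v *)
From mathcomp Require Import all_boot all_order all_algebra.
From mathcomp Require Import all_classical all_reals all_analysis.

Set Implicit Arguments.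
Unset Strict Implicit.
Unset Printing Implicit Defensive.

Import Order.TTheory GRing.Theory Num.Theory.
Import numFieldNormedType.Exports.

Local Open Scope classical_set_scope.
Local Open Scope ring_scope.

(* A function on [0,1], on [0,1]^2 or on the triangle is encoded as a total   *)
(* function on R or R * R; no definition below depends on the values taken    *)
(* outside of these sets (except that processes are measurable everywhere).   *)

(** Hölder classes on the triangle *)

(* The largest natural number k < g (strict inequality), for g > 0; every     *)
(* such k is at most truncn g, so the range of the maximum loses nothing.     *)
Definition strict_floor (R : realType) (g : R) : nat :=
  (\max_(k < (Num.truncn g).+1 | (k%:R < g)%R) k)%N.

Definition triangle (R : realType) : set (R * R) :=
  [set v | [/\ 0 <= v.1, v.1 <= v.2 & v.2 <= 1]].
Arguments triangle : clear implicits.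

(* D a b is the partial derivative of order a in x and b in y of f, for       *)
(* a + b <= k. At the corners (0,0) and (1,1) the horizontal, respectively    *)
(* vertical, slice of the triangle is a single point: as usual on a closed    *)
(* domain, the derivatives are taken in the interior and are required to      *)
(* extend continuously to the triangle, the extensions giving their values    *)
(* on the boundary. Thus D a b is unique on the triangle.                     *)
Definition partial_derivatives (R : realType) (k : nat) (f : R * R -> R)
    (D : nat -> nat -> R * R -> R) : Prop :=
  [/\ forall v, triangle R v -> D 0%N 0%N v = f v,
      forall a b, (a + b <= k)%N ->
        {within triangle R, continuous (D a b)} &
      forall a b v, (a + b < k)%N -> interior (triangle R) v ->
        is_derive v (1, 0) (D a b) (D a.+1 b v) /\
        is_derive v (0, 1) (D a b) (D a b.+1 v)].

(* The norm of R * R is the maximum norm. *)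
Definition holder_norm (R : realType) (g : R) (D : nat -> nat -> R * R -> R)
    : \bar R :=
  let k := strict_floor g in
  (\big[maxe/0]_(s : 'I_k.+1 * 'I_k.+1 | (s.1 + s.2 <= k)%N)
     ereal_sup [set `|D s.1 s.2 v|%:E | v in triangle R] +
   \big[maxe/0]_(s : 'I_k.+1 * 'I_k.+1 | (s.1 + s.2 == k)%N)
     ereal_sup [set (`|D s.1 s.2 vw.1 - D s.1 s.2 vw.2|
                       / `|vw.1 - vw.2| `^ (g - k%:R))%:E
               | vw in [set vw : (R * R) * (R * R) |
                   [/\ triangle R vw.1, triangle R vw.2 & vw.1 != vw.2]]])%E.

Definition holder_class (R : realType) (g L : R) : set (R * R -> R) :=
  [set f | exists D, partial_derivatives (strict_floor g) f D /\
                     (holder_norm g D <= L%:E)%E].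

(** Laws and independence *)

Definition has_law (R : realType) (d : measure_display) (T : measurableType d)
    (P : probability T R) (X : T -> R) (nu : set R -> \bar R) : Prop :=
  forall B : set R, measurable B -> P (X @^-1` B) = nu B.

(* normal_prob m s has standard deviation s, and normal_prob m 0 is the       *)
(* uniform law on [0,1] and not the degenerate normal law, so the case s = 0  *)
(* is treated apart.                                                          *)
Definition gaussian_law (R : realType) (m s : R) : set R -> \bar R :=
  if s == 0 then \d_m else normal_prob m s.

Definition mutually_independent (R : realType) (d : measure_display)
    (T : measurableType d) (P : probability T R) (I : finType)
    (F : I -> set (set T)) : Prop :=
  forall (J : {set I}) (A : I -> set T), (forall i, i \in J -> F i (A i)) ->
    P (\bigcap_(i in [set` J]) A i) = (\prod_(i in J) P (A i))%E.

Definition independent (R : realType) (d : measure_display)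
    (T : measurableType d) (P : probability T R) (F G : set (set T)) : Prop :=
  forall A B, F A -> G B -> P (A `&` B) = (P A * P B)%E.

Definition sigma_join (T I : Type) (F : I -> set (set T)) : set (set T) :=
  <<s \bigcup_i F i >>.

(** Processes *)

Definition process (R : realType) (d : measure_display) (T : measurableType d)
    (P : probability T R) : Type := R -> {RV P >-> R}.

Definition path_of (R : realType) (d : measure_display) (T : measurableType d)
    (P : probability T R) (Z : process P) (w : T) : R -> R := fun t => Z t w.

(* The product sigma-algebra of R^[0,1]. *)
Definition cylinder (R : realType) : set (set (R -> R)) :=
  <<s \bigcup_(t in `[(0:R), 1])
        preimage_set_system setT (fun f : R -> R => f t) measurable >>.
Arguments cylinder : clear implicits.

Definition sigma_process (R : realType) (d : measure_display)
    (T : measurableType d) (P : probability T R) (Z : process P) :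
    set (set T) :=
  preimage_set_system setT (path_of Z) (cylinder R).

Definition same_law (R : realType) (d d' : measure_display)
    (T : measurableType d) (T' : measurableType d') (P : probability T R)
    (P' : probability T' R) (Z : process P) (Z' : process P') : Prop :=
  forall C, cylinder R C -> P (path_of Z @^-1` C) = P' (path_of Z' @^-1` C).

Definition cov_kernel (R : realType) (d : measure_display)
    (T : measurableType d) (P : probability T R) (Z : process P)
    (v : R * R) : R :=
  fine ('E_P[fun w => (Z v.1 w * Z v.2 w)%R])%E.

Definition centered (R : realType) (d : measure_display)
    (T : measurableType d) (P : probability T R) (Z : process P) : Prop :=
  forall t, t \in `[(0:R), 1] -> ('E_P[Z t] = 0)%E.

Definition gaussian_process (R : realType) (d : measure_display)
    (T : measurableType d) (P : probability T R) (Z : process P) : Prop :=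
  forall (m : nat) (t c : 'I_m -> R), (forall k, t k \in `[(0:R), 1]) ->
    exists mean sd, 0 <= sd /\
      has_law P (fun w => \sum_(k < m) c k * Z (t k) w) (gaussian_law mean sd).

Definition gaussian_class (R : realType) (g L : R) (d : measure_display)
    (T : measurableType d) (P : probability T R) (Z : process P) : Prop :=
  [/\ gaussian_process Z, centered Z & holder_class g L (cov_kernel Z)].

(** The observation model *)

Definition is_design (R : realType) (p : nat) (x : 'I_p -> R) : Prop :=
  (forall j, x j \in `[(0:R), 1]) /\
  (forall j k : 'I_p, (j < k)%N -> x j < x k).

(* Zs i, i < n, are i.i.d. copies of Z, and the eps i j are i.i.d. normal     *)
(* with variance sigma0 ^+ 2 and independent of the copies.                   *)
Definition noise_model (R : realType) (sigma0 : R)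
    (d0 : measure_display) (T0 : measurableType d0) (P0 : probability T0 R)
    (Z : process P0) (d : measure_display) (T : measurableType d)
    (P : probability T R) (n p : nat) (Zs : 'I_n -> process P)
    (eps : 'I_n -> 'I_p -> {RV P >-> R}) : Prop :=
  let sigma_Z i := sigma_process (Zs i) in
  let sigma_eps (ij : 'I_n * 'I_p) :=
    preimage_set_system setT (eps ij.1 ij.2) measurable in
  [/\ forall i, same_law (Zs i) Z,
      mutually_independent P sigma_Z,
      forall i j, has_law P (eps i j) (normal_prob 0 sigma0),
      mutually_independent P sigma_eps &
      independent P (sigma_join sigma_Z) (sigma_join sigma_eps)].

Definition observations (R : realType) (d : measure_display)
    (T : measurableType d) (P : probability T R) (n p : nat) (mu : R -> R)
    (x : 'I_p -> R) (Zs : 'I_n -> process P)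
    (eps : 'I_n -> 'I_p -> {RV P >-> R}) (w : T) : n.-tuple (p.-tuple R) :=
  [tuple [tuple mu (x j) + Zs i (x j) w + eps i j w | j < p] | i < n].

(** Estimators and risk *)

Definition unit_square (R : realType) : set (R * R) :=
  [set v | v.1 \in `[(0:R), 1] /\ v.2 \in `[(0:R), 1]].
Arguments unit_square : clear implicits.

(* Measurability is with respect to the product sigma-algebra on functions    *)
(* on [0,1]^2, i.e. every evaluation of the estimator is measurable.          *)
Definition is_estimator (R : realType) (n p : nat)
    (G : n.-tuple (p.-tuple R) -> R * R -> R) : Prop :=
  forall v, unit_square R v -> measurable_fun setT (fun y => G y v).

Definition sup_norm (R : realType) (f : R * R -> R) : \bar R :=
  ereal_sup [set `|f v|%:E | v in unit_square R].

(* The integral of a nonnegative function is the supremum of the integrals    *)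
(* of the simple functions below it: it is the expectation if the loss is     *)
(* measurable, and the lower expectation otherwise.                           *)
Definition risk (R : realType) (n p : nat) (mu : R -> R) (x : 'I_p -> R)
    (G : n.-tuple (p.-tuple R) -> R * R -> R)
    (d0 : measure_display) (T0 : measurableType d0) (P0 : probability T0 R)
    (Z : process P0) (d : measure_display) (T : measurableType d)
    (P : probability T R) (Zs : 'I_n -> process P)
    (eps : 'I_n -> 'I_p -> {RV P >-> R}) : \bar R :=
  (\int[P]_w
     sup_norm (fun v => (G (observations mu x Zs eps w) v - cov_kernel Z v)%R))%E.

(* The supremum runs over the processes Z of the class, on any probability    *)
(* space, and over all realizations of the model for Z, on any probability    *)
(* space; the law of the observations depends only on the law of Z.           *)
Definition scaled_risks (R : realType) (g L sigma0 a : R) (n p : nat)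
    (mu : R -> R) (x : 'I_p -> R) (G : n.-tuple (p.-tuple R) -> R * R -> R) :
    set (\bar R) :=
  [set r | exists (d0 : measure_display) (T0 : measurableType d0)
                  (P0 : probability T0 R) (Z : process P0)
                  (d : measure_display) (T : measurableType d)
                  (P : probability T R) (Zs : 'I_n -> process P)
                  (eps : 'I_n -> 'I_p -> {RV P >-> R}),
     [/\ gaussian_class g L Z, noise_model sigma0 Z Zs eps &
         r = (a^-1%:E * risk mu x G Z Zs eps)%E]].

Definition minimax_risk (R : realType) (g L sigma0 a : R) (n p : nat)
    (mu : R -> R) (x : 'I_p -> R) : \bar R :=
  ereal_inf [set ereal_sup (scaled_risks g L sigma0 a mu x G) |
              G in @is_estimator R n p].

Definition rate (R : realType) (g : R) (n p : nat) : R :=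
  Num.max (p%:R `^ (- g))
    (Num.max ((ln (n * p)%:R / (n * p)%:R) `^ (g / (2 * g + 1)))
             (n%:R `^ (- 2^-1))).

(* Main.v *)
Require Import Defs.
From HB Require Import structures.
From mathcomp Require Import all_boot all_order all_algebra.
From mathcomp Require Import all_classical all_reals all_analysis.
From mathcomp Require Import measurable_realfun.
From mathcomp Require Import zify ring lra.

Set Implicit Arguments.
Unset Strict Implicit.
Unset Printing Implicit Defensive.

Import Order.TTheory GRing.Theory Num.Theory.
Import numFieldNormedType.Exports.

Local Open Scope classical_set_scope.
Local Open Scope ring_scope.

(** Every hypothesis used for the lower bound is a rank-one Gaussian process
    Z = xi f with xi standard normal and f a deterministic function. Its
    covariance kernel is v f(x) f(y) with v the variance of xi, so a function f
    with k derivatives and a (g - k)-Hölder k-th derivative gives a process of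
    the class ([holder_class_rank_one]). The null function is a constant b; the
    constant b is small enough for the Hölder bound L, and three alternatives
    correspond to the three terms of the rate.

    - Term p^(-g): cut [0,1] into p + 1 bins. One of them contains no design
      point ([empty_bin]), so that b plus a bump of width h = 1 / (p + 1) and
      height of order h^g inside that bin produces exactly the same data.

    - Term (log(np) / (np))^(g / (2 g + 1)): cut [0,1] into bins of that width
      h = (log(np) / (np))^(1 / (2 g + 1)). At least half of them contain at
      most 2 p h design points ([many_light_bins]); each of these carries one
      alternative, a bump of height of order h^g. Conditionally on the xi_i the
      bump only translates the Gaussian errors, by vectors with disjoint
      supports for different bins. The likelihood ratio W of the uniform mixture
      of m alternatives against the null hypothesis therefore has a second
      moment of at most 1 + exp(V) / m, where V is a small multiple of log(np)
      as soon as the sum of the xi_i^2 does not exceed twice its mean, an event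
      of probability at least 1/2 ([data_shift_test]).

    - Term n^(-1/2): the alternative is the constant b (1 + 1 / (6 sqrt n)). It
      rescales the xi_i, and the likelihood ratio of n centered normal variables
      under such a change of scale has a bounded second moment
      ([data_scale_test]).

    A likelihood ratio W >= 0 with mean 1 and second moment at most C satisfies
    E min(1, W) >= 1 / C, whence no test separates the null hypothesis from the
    mixture ([likelihood_ratio_test]). An estimator whose risk is small for all
    hypotheses would give such a test: reject when
    the estimate is far from the null kernel at one of finitely many points, the
    midpoints of the bins in the case of bumps ([testing_reduction]). *)

(** * Integration against a measure given by a density *)

Section measure_with_density.
Context d (T : measurableType d) (R : realType).
Variables (mu nu : {measure set T -> \bar R}) (f : T -> R).
Hypothesis f_ge0 : forall x, 0 <= f x.
Hypothesis mf : measurable_fun setT f.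
Hypothesis nuE : forall A, measurable A -> nu A = (\int[mu]_(x in A) (f x)%:E)%E.

Import HBNNSimple.
Local Open Scope ereal_scope.

(** Both sides agree on indicators of measurable sets by hypothesis; linearity
    gives simple functions and monotone convergence the rest. *)
Lemma ge0_integral_density (h : T -> \bar R) :
  measurable_fun setT h -> (forall x, 0 <= h x) ->
  \int[nu]_x h x = \int[mu]_x (h x * (f x)%:E).
Proof.
move=> mh h0; pose h_ := nnsfun_approx measurableT mh.
have cvgh x : (h_ n x)%:E @[n --> \oo] --> h x.
  by apply: cvg_nnsfun_approx.
have mhf n : measurable_fun setT (fun x => (h_ n x * f x)%:E).
  by apply/measurable_EFinP/measurable_funM.
transitivity (limn (fun n => \int[nu]_x (h_ n x)%:E)).
  rewrite -monotone_convergence//.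
  - by apply: eq_integral => x _; apply/esym/cvg_lim => //; exact: cvgh.
  - by move=> n; exact/measurable_EFinP.
  - by move=> n x _; rewrite lee_fin.
  - by move=> x _ m n mn; rewrite lee_fin; exact/lefP/nd_nnsfun_approx.
transitivity (limn (fun n => \int[mu]_x (h_ n x * f x)%:E)); last first.
  rewrite -monotone_convergence//.
  - apply: eq_integral => x _; apply/cvg_lim => //.
    by under eq_fun do rewrite EFinM; apply: cvgeZr => //; exact: cvgh.
  - by move=> n x _; rewrite lee_fin mulr_ge0.
  - move=> x _ m n mn; rewrite lee_fin ler_wpM2r//.
    exact/lefP/nd_nnsfun_approx.
congr (limn _); apply/funext => n.
transitivity (\sum_(r \in range (h_ n))
    \int[nu]_x (r * \1_(h_ n @^-1` [set r]) x)%:E).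
  under eq_integral do rewrite fimfunE -fsumEFin//.
  rewrite ge0_integral_fsum//.
  - by move=> y; exact/measurable_EFinP/measurable_funM.
  - by move=> y x _; rewrite nnfun_muleindic_ge0.
transitivity (\sum_(r \in range (h_ n))
    \int[mu]_x ((r * \1_(h_ n @^-1` [set r]) x) * f x)%:E); last first.
  rewrite -ge0_integral_fsum//.
  - apply: eq_integral => x _.
    by rewrite fsumEFin// -mulr_fsuml -fimfunE.
  - move=> r; apply/measurable_EFinP/measurable_funM => //.
    by apply: measurable_funM.
  - by move=> r x _; rewrite EFinM mule_ge0 ?lee_fin// -lee_fin EFinM nnfun_muleindic_ge0.
apply: eq_fsbigr => r /set_mem [x _ xr].
have r0 : (0 <= r)%R by rewrite -xr.
have mA : measurable (h_ n @^-1` [set r]) by [].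
under eq_integral do rewrite EFinM.
rewrite ge0_integralZl//; last exact/measurable_EFinP.
rewrite integral_indic// setIT nuE//.
under [RHS]eq_integral do rewrite -mulrA EFinM.
rewrite ge0_integralZl//; first last.
- by move=> y _; rewrite lee_fin mulr_ge0.
- by apply/measurable_EFinP/measurable_funM.
congr (_ * _); rewrite [LHS]integral_mkcond; apply: eq_integral => y _.
rewrite patchE indicE; case: ifPn => _; by rewrite ?mul1r ?mul0r.
Qed.

End measure_with_density.

(** * Affine images and changes of measure for normal laws *)

Section normal_law.
Context {R : realType}.
Implicit Types (a b m s : R) (h : R -> \bar R).
Local Notation mu := (@lebesgue_measure R).

Lemma measurable_affine a b :
  measurable_fun [set: measurableTypeR R]
    ((fun x => a * x + b) : _ -> measurableTypeR R).
Proof.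
rewrite -[measurable_fun _ _]/(measurable_fun [set: R] (fun x : R => a * x + b)).
by apply: measurable_funD => //; apply: measurable_funM. Qed.

(** The left-hand side is a measure, so by uniqueness of Lebesgue measure it
    suffices to compare both sides on half-open intervals, whose preimages are
    intervals again (with the bounds exchanged for a < 0). *)
Lemma lebesgue_measure_affine a b (A : set R) : a != 0 -> measurable A ->
  (`|a|%:E * mu ((fun x => a * x + b)%R @^-1` A) = mu A)%E.
Proof.
move=> a0 mA.
pose phi : measurableTypeR R -> measurableTypeR R := fun x => a * x + b.
pose nu : {measure set (measurableTypeR R) -> \bar R} :=
  mscale (NngNum (normr_ge0 a)) (pushforward mu phi).
(* nu takes the measurability of phi as an argument *)
rewrite -[LHS]/(nu (measurable_affine a b) A); apply/esym/lebesgue_measure_unique => // _ [[u v]] _ <-.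
rewrite -[RHS]/(`|a|%:E * mu ((fun x => a * x + b)%R @^-1` `]u, v]))%E.
rewrite lebesgue_measure_itv/= lte_fin.
have [a_gt0|a_le0] := ltP 0 a.
  have -> : (fun x => a * x + b) @^-1` `]u, v] =
            `](u - b) / a, (v - b) / a]%classic.
    apply/seteqP; split=> x/=; rewrite !in_itv/=;
      by rewrite ltr_pdivrMr// ler_pdivlMr// ltrBlDr lerBrDr mulrC.
  rewrite lebesgue_measure_itv/= lte_fin ltr_pM2r ?invr_gt0// ltrD2r gtr0_norm//.
  case: ifP => _; last by rewrite mule0.
  by rewrite -!EFinD -EFinM; congr EFin; field.
have a_lt0 : a < 0 by rewrite lt_neqAle a0.
have -> : (fun x => a * x + b) @^-1` `]u, v] =
          `[(v - b) / a, (u - b) / a[%classic.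
  apply/seteqP; split=> x/=; rewrite !in_itv/=;
    by rewrite ltr_ndivlMr// ler_ndivrMr// ltrBlDr lerBrDr mulrC andbC.
rewrite lebesgue_measure_itv/= lte_fin ltr_nM2r ?invr_lt0// ltrD2r ltr0_norm//.
case: ifP => _; last by rewrite mule0.
by rewrite -!EFinD -EFinM; congr EFin; field.
Qed.

Lemma ge0_integral_affine a b h : a != 0 -> measurable_fun setT h ->
  (forall x, 0 <= h x)%E ->
  (\int[mu]_x h x = `|a|%:E * \int[mu]_x h (a * x + b)%R)%E.
Proof.
move=> a0 mh h0.
pose phi : measurableTypeR R -> measurableTypeR R := fun x => a * x + b.
pose nu : {measure set (measurableTypeR R) -> \bar R} := pushforward mu phi.
transitivity (`|a|%:E * \int[nu (measurable_affine a b)]_x h x)%E; last first.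
  by rewrite (ge0_integral_pushforward (measurable_affine a b))// preimage_setT.
rewrite -(ge0_integral_mscale _ measurableT (NngNum (normr_ge0 a)))//.
apply: eq_measure_integral => A mA _.
exact/esym/(lebesgue_measure_affine b a0 mA).
Qed.

Lemma ge0_integral_normal_prob m s h : measurable_fun setT h ->
  (forall x, 0 <= h x)%E ->
  (\int[normal_prob m s]_x h x = \int[mu]_x (h x * (normal_pdf m s x)%:E))%E.
Proof.
move=> mh h0; apply: ge0_integral_density => //.
- exact: normal_pdf_ge0.
- exact: measurable_normal_pdf.
Qed.

Lemma normal_peakM (a s : R) : 0 < a -> normal_peak (a * s) = a^-1 * normal_peak s.
Proof.
move=> a0; rewrite /normal_peak.
have -> : (a * s) ^+ 2 * pi *+ 2 = a ^+ 2 * (s ^+ 2 * pi *+ 2).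
  by rewrite exprMn; ring.
by rewrite sqrtrM ?sqr_ge0// sqrtr_sqr gtr0_norm// invfM.
Qed.

Lemma normal_pdf_affine a b m s x : a != 0 -> s != 0 ->
  normal_pdf m s x = `|a| * normal_pdf (a * m + b) (`|a| * s) (a * x + b).
Proof.
move=> a0 s0; rewrite !normal_pdfE ?mulf_neq0 ?normr_eq0//.
rewrite mulrA; congr (_ * _).
  rewrite normal_peakM ?normr_gt0// mulrA mulfV ?mul1r ?normr_eq0//.
rewrite /normal_fun; congr expR.
rewrite exprMn -[`|a| ^+ 2]normrX (ger0_norm (sqr_ge0 a)).
by field; rewrite a0 s0.
Qed.

(** Image of a normal law by an affine map, as a change of variables in the
    Lebesgue integral of the density. *)
Lemma ge0_integral_normal_affine a b m s h : a != 0 -> s != 0 ->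
  measurable_fun setT h -> (forall x, 0 <= h x)%E ->
  (\int[normal_prob m s]_x h (a * x + b)%R =
   \int[normal_prob (a * m + b) (`|a| * s)]_x h x)%E.
Proof.
move=> a0 s0 mh h0.
have mha : measurable_fun setT (fun x => h (a * x + b)).
  exact: (measurableT_comp mh (measurable_affine a b)).
rewrite (ge0_integral_normal_prob _ _ mh h0).
rewrite (ge0_integral_normal_prob _ _ mha (fun x => h0 _)).
have mn : measurable_fun setT
    (fun x => h x * (normal_pdf (a * m + b) (`|a| * s) x)%:E)%E.
  apply: emeasurable_funM => //; apply/measurable_EFinP.
  exact: measurable_normal_pdf.
rewrite [RHS](ge0_integral_affine b a0)//; last first.
  by move=> x; rewrite mule_ge0// lee_fin normal_pdf_ge0.
rewrite -ge0_integralZl//; last 2 first.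
- exact: (measurableT_comp mn (measurable_affine a b)).
- by move=> x _; rewrite mule_ge0// lee_fin normal_pdf_ge0.
apply: eq_integral => x _.
by rewrite (normal_pdf_affine b m x a0 s0) EFinM muleCA.
Qed.

(** L is the likelihood ratio of two normal laws; it is left as a parameter
    because shifts and scalings each have a simple explicit one. *)
Lemma ge0_integral_normal_change m s m' s' (L : R -> R) h :
  measurable_fun setT L -> (forall x, 0 <= L x) ->
  (forall x, normal_pdf m' s' x = L x * normal_pdf m s x) ->
  measurable_fun setT h -> (forall x, 0 <= h x)%E ->
  (\int[normal_prob m' s']_x h x = \int[normal_prob m s]_x (h x * (L x)%:E))%E.
Proof.
move=> mL L0 LE mh h0.
have mhL : measurable_fun setT (fun x => h x * (L x)%:E)%E.
  by apply: emeasurable_funM => //; exact/measurable_EFinP.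
have hL0 x : (0 <= h x * (L x)%:E)%E by rewrite mule_ge0// lee_fin.
rewrite (ge0_integral_normal_prob _ _ mh h0).
rewrite (ge0_integral_normal_prob _ _ mhL hL0).
by apply: eq_integral => x _; rewrite LE EFinM muleA.
Qed.

End normal_law.

(** * Finite products of a probability measure *)

Section iid_product.
Context d (T : measurableType d) (R : realType) (P : probability T R).
Local Open Scope ereal_scope.

Definition tuple_cons n (x : T * n.-tuple T) : n.+1.-tuple T :=
  [tuple of x.1 :: x.2].

Lemma measurable_tuple_cons n : measurable_fun setT (@tuple_cons n).
Proof. exact: measurable_cons. Qed.

HB.instance Definition _ n :=
  isMeasurableFun.Build _ _ _ _ (@tuple_cons n) (@measurable_tuple_cons n).

(** Built by recursion on the number of coordinates rather than through an
    abstract product measure, so that statements on n coordinates reduce to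
    Tonelli's theorem on one coordinate and the others. *)
Fixpoint iid n : probability (n.-tuple T) R :=
  match n with
  | 0 => \d_[tuple]
  | m.+1 => distribution (P \x iid m) (@tuple_cons m)
  end.

Lemma ge0_integral_iid0 (h : 0.-tuple T -> \bar R) :
  measurable_fun setT h -> \int[iid 0]_w h w = h [tuple].
Proof. by move=> mh; rewrite integral_dirac// diracT mul1e. Qed.

Lemma ge0_integral_iidS n (h : n.+1.-tuple T -> \bar R) :
  measurable_fun setT h -> (forall w, 0 <= h w) ->
  \int[iid n.+1]_w h w = \int[P]_x \int[iid n]_w h (tuple_cons (x, w)).
Proof.
move=> mh h0.
rewrite [LHS](ge0_integral_distribution (@tuple_cons n))//.
rewrite fubini_tonelli1// => [|z]; last exact: h0.
exact: (measurableT_comp mh (@measurable_tuple_cons n)).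
Qed.

Lemma ge0_integral_iid_prod n (h : 'I_n -> T -> R) :
  (forall i, measurable_fun setT (h i)) -> (forall i x, (0 <= h i x)%R) ->
  \int[iid n]_w (\prod_(i < n) h i (tnth w i))%:E =
  \prod_(i < n) \int[P]_x (h i x)%:E.
Proof.
elim: n h => [|n IHn] h mh h0.
  rewrite ge0_integral_iid0; first by rewrite !big_ord0.
  by under eq_fun do rewrite big_ord0; exact: measurable_cst.
have mprod m (g : 'I_m -> T -> R) : (forall i, measurable_fun setT (g i)) ->
    measurable_fun setT (fun w : m.-tuple T => \prod_(i < m) g i (tnth w i))%R.
  move=> mg; apply: measurable_prod => i _.
  by apply: measurableT_comp (mg i) _; exact: measurable_tnth.
have ge0prod m (g : 'I_m -> T -> R) (w : m.-tuple T) : (forall i x, (0 <= g i x)%R) ->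
    (0 <= \prod_(i < m) g i (tnth w i))%R.
  by move=> g0; apply: prodr_ge0 => i _.
rewrite ge0_integral_iidS; last 2 first.
- by apply/measurable_EFinP; exact: mprod.
- by move=> w; rewrite lee_fin ge0prod.
pose h' i := h (lift ord0 i).
have mh' : measurable_fun setT
    (fun w : n.-tuple T => (\prod_(i < n) h' i (tnth w i))%:E).
  by apply/measurable_EFinP; apply: (mprod n h') => i; exact: mh.
transitivity (\int[P]_x ((h ord0 x)%:E * \prod_(i < n) \int[P]_y (h' i y)%:E)).
  apply: eq_integral => x _; rewrite -IHn => [|i|i y]; last 2 first.
  - exact: mh.
  - exact: h0.
  rewrite -ge0_integralZl//.
  2: by move=> w _; rewrite lee_fin (ge0prod _ h')// => i y; exact: h0.
  2: by rewrite lee_fin.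
  apply: eq_integral => w _; rewrite big_ord_recl /tuple_cons/= tnth0 EFinM.
  by under eq_bigr do rewrite tnthS.
rewrite big_ord_recl.
rewrite /= ge0_integralZr//.
- by apply/measurable_EFinP.
- by move=> x _; rewrite lee_fin.
- by apply: prode_ge0 => i _; apply: integral_ge0 => x _; rewrite lee_fin; exact: h0.
Qed.

(** Change of variables coordinate by coordinate. If the image of P by each
    tau i has density L i with respect to P, the image of the product measure
    has the product of these densities. Stated with functions instead of
    measures so that shifts and scalings are treated at once. *)
Lemma ge0_integral_iid_change n (tau : 'I_n -> T -> T) (L : 'I_n -> T -> R)
    (h : n.-tuple T -> \bar R) :
  (forall i, measurable_fun setT (tau i)) ->
  (forall i, measurable_fun setT (L i)) -> (forall i x, (0 <= L i x)%R) ->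
  (forall i g, measurable_fun setT g -> (forall x, 0 <= g x) ->
     \int[P]_x g (tau i x) = \int[P]_x (g x * (L i x)%:E)) ->
  measurable_fun setT h -> (forall w, 0 <= h w) ->
  \int[iid n]_w h [tuple tau i (tnth w i) | i < n] =
  \int[iid n]_w (h w * (\prod_(i < n) L i (tnth w i))%:E).
Proof.
have mtau m (t : 'I_m -> T -> T) : (forall i, measurable_fun setT (t i)) ->
    measurable_fun setT (fun w : m.-tuple T => [tuple t i (tnth w i) | i < m]).
  move=> mt; apply/measurable_fun_tnthP => i.
  rewrite [X in measurable_fun _ X](_ : _ = fun w => t i (tnth w i)); last first.
    by apply/funext => w; rewrite /= tnth_mktuple.
  by apply: measurableT_comp (mt i) _; exact: measurable_tnth.
have mprod m (g : 'I_m -> T -> R) : (forall i, measurable_fun setT (g i)) ->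
    measurable_fun setT (fun w : m.-tuple T => \prod_(i < m) g i (tnth w i))%R.
  move=> mg; apply: measurable_prod => i _.
  by apply: measurableT_comp (mg i) _; exact: measurable_tnth.
elim: n tau L h => [|n IHn] tau L h mt mL L0 tauE mh h0.
  rewrite !ge0_integral_iid0.
  - rewrite big_ord0 mule1; congr h; exact: tuple0.
  - by apply: emeasurable_funM => //; apply/measurable_EFinP; exact: mprod.
  - by apply: measurableT_comp => //; exact: mtau.
have prodL0 m (g : 'I_m -> T -> R) (w : m.-tuple T) : (forall i x, (0 <= g i x)%R) ->
    0 <= (\prod_(i < m) g i (tnth w i))%:E.
  by move=> g0; rewrite lee_fin; apply: prodr_ge0 => i _.
rewrite ge0_integral_iidS//; last first.
  by apply: measurableT_comp => //; exact: mtau.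
rewrite ge0_integral_iidS; last 2 first.
- by apply: emeasurable_funM => //; apply/measurable_EFinP; exact: mprod.
- by move=> w; rewrite mule_ge0// prodL0.
pose tau' i := tau (lift ord0 i); pose L' i := L (lift ord0 i).
pose F x := \int[iid n]_w (h (tuple_cons (x, w)) * (\prod_(i < n) L' i (tnth w i))%:E).
have mF : measurable_fun setT F.
  apply: (@measurable_fun_fubini_tonelli_F _ _ _ _ _ (iid n)
    (fun z => h (tuple_cons z) * (\prod_(i < n) L' i (tnth z.2 i))%:E)).
    2: by move=> z; rewrite mule_ge0// prodL0// => i y; exact: L0.
  apply: emeasurable_funM.
    exact: (measurableT_comp mh (@measurable_tuple_cons n)).
  apply/measurable_EFinP; apply: (measurableT_comp (mprod _ _ _)) => //.
  by move=> i; exact: mL.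
have F0 x : 0 <= F x.
  by apply: integral_ge0 => w _; rewrite mule_ge0// prodL0// => i y; exact: L0.
have mhx x : measurable_fun setT (fun w => h (tuple_cons (x, w))).
  have mc := measurableT_comp (@measurable_tuple_cons n) (pair1_measurable x).
  exact: (measurableT_comp mh mc).
transitivity (\int[P]_x F (tau ord0 x)).
  apply: eq_integral => x _.
  rewrite /F -(IHn tau' L' (fun w => h (tuple_cons (tau ord0 x, w)))
    (fun i => mt _) (fun i => mL _) (fun i => L0 _) (fun i => tauE _)
    (mhx _) (fun w => h0 _)).
  apply: eq_integral => w _; congr h; apply: eq_from_tnth => i.
  rewrite tnth_mktuple; case: (unliftP ord0 i) => [j ->|->].
    by rewrite /tuple_cons/= !tnthS tnth_mktuple.
  by rewrite /tuple_cons/= !tnth0.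
rewrite (tauE ord0 F mF F0); apply: eq_integral => x _.
rewrite /F -ge0_integralZr ?lee_fin//.
2: by apply: emeasurable_funM => //; apply/measurable_EFinP; apply: (mprod n L') => i; exact: mL.
2: by move=> w _; rewrite mule_ge0// (prodL0 _ L')// => i y; exact: L0.
apply: eq_integral => w _.
rewrite big_ord_recl /tuple_cons/= tnth0 EFinM.
under [in RHS]eq_bigr do rewrite tnthS.
by rewrite -muleA; congr (_ * _); rewrite muleC.
Qed.

End iid_product.

(** * Testing by the second moment of the likelihood ratio *)

Section likelihood_ratio.
Context d (T : measurableType d) (R : realType) (P : probability T R).

(** Pointwise 1_B + W 1_(~ B) >= min(1, W) >= l W - l^2 W^2 / 4 for every l in
    [0, 1], the last step being (l W / 2 - 1)^2 >= 0 or l <= 1. Integrating with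
    l = 2 / C yields 2 / C - 1 / C. *)
Lemma likelihood_ratio_test (W : T -> R) (C : R) (B : set T) :
  measurable_fun setT W -> (forall x, 0 <= W x) ->
  (\int[P]_x (W x)%:E = 1)%E -> (\int[P]_x (W x ^+ 2)%:E <= C%:E)%E ->
  2 <= C -> measurable B ->
  ((C^-1)%:E <= P B + \int[P]_x (W x * \1_(~` B) x)%:E)%E.
Proof.
move=> mW W0 W1 W2 C2 mB.
have C0 : 0 < C by apply: lt_le_trans C2.
set X := (X in (_ <= X)%E).
have mWB : measurable_fun setT (fun x => W x * \1_(~` B) x).
  by apply: measurable_funM => //; apply: measurable_indic; exact: measurableC.
have mW2 : measurable_fun setT (fun x => (C^-1 ^+ 2 * W x ^+ 2)).
  by apply: measurable_funM => //; exact: measurable_funX.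
suff : ((2 / C)%:E <= X + (C^-1)%:E)%E.
  rewrite -leeBlDr// -EFinB; congr (_ <= _)%E; congr EFin.
  by field; rewrite gt_eqF.
apply: (@le_trans _ _ (X + \int[P]_x (C^-1 ^+ 2 * W x ^+ 2)%:E)%E); last first.
  rewrite leeD2l//; under eq_integral do rewrite EFinM.
  rewrite ge0_integralZl//.
  - apply: (@le_trans _ _ ((C^-1 ^+ 2)%:E * C%:E)%E).
      by apply: lee_wpmul2l => //; rewrite lee_fin sqr_ge0.
    by rewrite -EFinM expr2 mulfVK// gt_eqF.
  - by apply/measurable_EFinP; exact: measurable_funX.
  - by move=> x _; rewrite lee_fin sqr_ge0.
  - by rewrite lee_fin sqr_ge0.
have -> : (2 / C)%:E = (\int[P]_x ((2 / C) * W x)%:E)%E.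
  under eq_integral do rewrite EFinM.
  rewrite ge0_integralZl// ?W1 ?mule1//.
  - exact/measurable_EFinP.
  - by move=> x _; rewrite lee_fin.
  - by rewrite lee_fin divr_ge0 // ltW.
rewrite /X -{1}(setIT B) -integral_indic// -ge0_integralD//=; last 3 first.
- exact/measurable_EFinP/measurable_indic.
- by move=> x _; rewrite lee_fin mulr_ge0.
- exact/measurable_EFinP.
rewrite -ge0_integralD//=; last 4 first.
- by move=> x _; rewrite -EFinD lee_fin addr_ge0// mulr_ge0.
- apply: emeasurable_funD; last exact/measurable_EFinP.
  exact/measurable_EFinP/measurable_indic.
- by move=> x _; rewrite lee_fin mulr_ge0// sqr_ge0.
- exact/measurable_EFinP.
apply: ge0_le_integral => //=.
- by move=> x _; rewrite lee_fin mulr_ge0 // divr_ge0 // ltW.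
- by apply/measurable_EFinP; apply: measurable_funM.
- apply: emeasurable_funD; last exact/measurable_EFinP.
  apply: emeasurable_funD; last exact/measurable_EFinP.
  exact/measurable_EFinP/measurable_indic.
move=> x _; rewrite -!EFinD lee_fin !indicE in_setC.
case: (x \in B) => /=.
  rewrite mulr0 addr0 -subr_ge0 (_ : _ - _ = (1 - C^-1 * W x) ^+ 2) ?sqr_ge0//.
  by ring.
rewrite add0r mulr1 -[leLHS]addr0 lerD//; last by rewrite mulr_ge0// sqr_ge0.
by rewrite -[leRHS]mul1r ler_wpM2r// ler_pdivrMr// mul1r.
Qed.

End likelihood_ratio.

Section mixture_test.
Context d (T : measurableType d) (R : realType) (P : probability T R).
Variables (n : nat) (J : finType).
Variables (tau : J -> 'I_n -> T -> T) (L : J -> 'I_n -> T -> R).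
Hypothesis mtau : forall k i, measurable_fun setT (tau k i).
Hypothesis mL : forall k i, measurable_fun setT (L k i).
Hypothesis L_ge0 : forall k i x, 0 <= L k i x.
Hypothesis tauE : forall k i (g : T -> \bar R), measurable_fun setT g ->
  (forall x, (0 <= g x)%E) ->
  (\int[P]_x g (tau k i x) = \int[P]_x (g x * (L k i x)%:E))%E.

Let shift k (w : n.-tuple T) := [tuple tau k i (tnth w i) | i < n].
Let density k (w : n.-tuple T) : R := \prod_(i < n) L k i (tnth w i).

Let mdensity k : measurable_fun setT (density k).
Proof.
apply: measurable_prod => i _.
by apply: measurableT_comp (mL k i) _; exact: measurable_tnth.
Qed.

Let density_ge0 k w : 0 <= density k w.
Proof. by apply: prodr_ge0 => i _. Qed.

(** The uniform mixture over k of the images of the product measure by the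
    coordinatewise maps tau k has a likelihood ratio whose second moment is the
    average over pairs (k, l) of products of one-dimensional integrals. *)
Lemma iid_mixture_test (K : J -> J -> R) (C : R) (B : set (n.-tuple T)) :
  (0 < #|J|)%N ->
  (forall k l, (\prod_(i < n) \int[P]_x (L k i x * L l i x)%:E <= (K k l)%:E)%E) ->
  \sum_k \sum_l K k l <= C * #|J|%:R ^+ 2 -> 2 <= C -> measurable B ->
  ((C^-1)%:E <= iid P n B +
     (#|J|%:R^-1)%:E * \sum_k iid P n (shift k @^-1` ~` B))%E.
Proof.
move=> J0 LK KC C2 mB.
have J0' : 0 < #|J|%:R :> R by rewrite ltr0n.
have L1 k i : (\int[P]_x (L k i x)%:E = 1)%E.
  transitivity (\int[P]_x (cst 1 x * (L k i x)%:E))%E.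
    by apply: eq_integral => x _; rewrite mul1e.
  by rewrite -tauE// integral_cst// mul1e; exact: probability_setT.
pose W w := #|J|%:R^-1 * \sum_k density k w.
have mS : measurable_fun setT (fun w => \sum_k density k w).
  by apply: measurable_sum => k; exact: mdensity.
have S0 w : 0 <= \sum_k density k w by apply: sumr_ge0.
have shiftE k : iid P n (shift k @^-1` ~` B) =
    (\int[iid P n]_w (density k w * \1_(~` B) w)%:E)%E.
  have mB1 : measurable_fun setT (fun w => (\1_(~` B) w : R)%:E).
    by apply/measurable_EFinP/measurable_indic; exact: measurableC.
  have mshift : measurable_fun setT (shift k).
    apply/measurable_fun_tnthP => i.
    rewrite [X in measurable_fun _ X](_ : _ = fun w => tau k i (tnth w i)).
      by apply: measurableT_comp (mtau k i) _; exact: measurable_tnth.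
    by apply/funext => w; rewrite /= tnth_mktuple.
  transitivity (\int[iid P n]_w (\1_(~` B) (shift k w))%:E)%E.
    have msB : measurable (shift k @^-1` ~` B).
      by rewrite -[X in measurable X]setTI; apply: mshift => //; exact: measurableC.
    rewrite -[RHS]/(\int[iid P n]_w (\1_(shift k @^-1` ~` B) w)%:E)%E.
    by rewrite integral_indic// setIT.
  rewrite (ge0_integral_iid_change (mtau k) (mL k) (L_ge0 k) (@tauE k) mB1)//.
  by apply: eq_integral => w _; rewrite -EFinM mulrC.
have -> : ((#|J|%:R^-1)%:E * \sum_k iid P n (shift k @^-1` ~` B) =
    \int[iid P n]_w (W w * \1_(~` B) w)%:E)%E.
  have mf k : measurable_fun setT (fun w => (density k w * \1_(~` B) w)%:E).
    apply/measurable_EFinP/measurable_funM => //.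
    by apply: measurable_indic; exact: measurableC.
  have f0 k w : (0 <= (density k w * \1_(~` B) w)%:E)%E.
    by rewrite lee_fin mulr_ge0.
  under eq_bigr do rewrite shiftE.
  rewrite -ge0_integral_sum// -ge0_integralZl//.
  - apply: eq_integral => w _; rewrite sumEFin -EFinM; congr EFin.
    by rewrite /W -mulr_suml mulrA.
  - exact: emeasurable_sum.
  - by move=> w _; apply: sume_ge0.
apply: likelihood_ratio_test => //.
- exact: measurable_funM.
- by move=> w; rewrite mulr_ge0// invr_ge0 ltW.
- under eq_integral do rewrite EFinM -sumEFin.
  rewrite ge0_integralZl//; last 2 first.
  + by apply: emeasurable_sum => k; exact/measurable_EFinP.
  + by move=> w _; apply: sume_ge0 => k _; rewrite lee_fin.
  rewrite ge0_integral_sum//; last 2 first.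
  + by move=> k; exact/measurable_EFinP.
  + by move=> k w _; rewrite lee_fin.
  rewrite (eq_bigr (fun k => (1:R)%:E)) => [|k _]; last first.
    by rewrite ge0_integral_iid_prod// big1 => // i _; exact: L1.
  by rewrite sumEFin sumr_const -EFinM mulVf// gt_eqF.
- pose D (q : J * J) (w : n.-tuple T) : R := density q.1 w * density q.2 w.
  have mD q : measurable_fun setT (D q) by exact: measurable_funM.
  have D0 q w : 0 <= D q w by rewrite mulr_ge0.
  have -> : (\int[iid P n]_w (W w ^+ 2)%:E =
      \int[iid P n]_w ((#|J|%:R^-1 ^+ 2)%:E * \sum_q (D q w)%:E))%E.
    apply: eq_integral => w _; rewrite /W exprMn EFinM; congr (_ * _)%E.
    rewrite sumEFin expr2 mulr_suml; congr EFin.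
    rewrite -(pair_bigA _ (fun k l => density k w * density l w))/=.
    by apply: eq_bigr => k _; rewrite mulr_sumr.
  rewrite ge0_integralZl//; last 2 first.
  + by apply: emeasurable_sum => q; exact/measurable_EFinP.
  + by move=> w _; apply: sume_ge0 => q _; rewrite lee_fin.
  rewrite ge0_integral_sum//; last 2 first.
  + by move=> q; exact/measurable_EFinP.
  + by move=> q w _; rewrite lee_fin.
  apply: (@le_trans _ _ ((#|J|%:R^-1 ^+ 2)%:E * (\sum_k \sum_l K k l)%:E)%E).
    apply: lee_wpmul2l; first by rewrite lee_fin sqr_ge0.
    rewrite pair_bigA/= -sumEFin; apply: lee_sum => -[k l] _.
    apply: le_trans (LK k l).
    rewrite -(ge0_integral_iid_prod P (h := fun i x => L k i x * L l i x)).
    + rewrite le_eqVlt; apply/orP; left; apply/eqP/eq_integral => w _; congr EFin.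
      by rewrite /D /density -big_split.
    + by move=> i; apply: measurable_funM.
    + by move=> i x; rewrite mulr_ge0.
  rewrite -EFinM lee_fin exprVn mulrC ler_pdivrMr//.
  by rewrite exprn_gt0.
Qed.

End mixture_test.

(** * Testing shifts and scalings of Gaussian vectors *)

Section gaussian_tests.
Context {R : realType}.

(** The density of N(c, s^2) with respect to N(0, s^2). *)
Definition shift_density (s c x : R) : R := expR ((2 * x * c - c ^+ 2) / (2 * s ^+ 2)).

Lemma measurable_shift_density s c : measurable_fun setT (shift_density s c).
Proof.
apply: measurableT_comp => //; apply: measurable_funM => //.
by apply: measurable_funB => //; apply: measurable_funM => //.
Qed.

Lemma ge0_integral_normal_shift (s c : R) (h : R -> \bar R) : 0 < s ->
  measurable_fun setT h -> (forall x, 0 <= h x)%E ->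
  (\int[normal_prob 0 s]_x h (x + c)%R =
   \int[normal_prob 0 s]_x (h x * (shift_density s c x)%:E))%E.
Proof.
move=> s0 mh h0.
under eq_integral => x _ do rewrite -[x in (x + c)%R]mul1r.
rewrite (ge0_integral_normal_affine c 0 (oner_neq0 R) (lt0r_neq0 s0) mh h0).
rewrite mulr0 add0r normr1 mul1r.
apply: ge0_integral_normal_change => //.
- exact: measurable_shift_density.
- by move=> x; exact: expR_ge0.
move=> x; rewrite !normal_pdfE ?gt_eqF// mulrCA; congr (_ * _).
rewrite -expRD; congr expR; by field; rewrite gt_eqF.
Qed.

(** The product of the densities of the shifts by c and c' is the constant
    exp(c c' / s^2) times the density of the shift by c + c'. *)
Lemma integral_shift_densityM (s c c' : R) : 0 < s ->
  (\int[normal_prob 0 s]_x (shift_density s c x * shift_density s c' x)%:E =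
   (expR (c * c' / s ^+ 2))%:E)%E.
Proof.
move=> s0; transitivity (\int[normal_prob 0 s]_x
  ((expR (c * c' / s ^+ 2))%:E * (shift_density s (c + c') x)%:E))%E.
  apply: eq_integral => x _; rewrite -!EFinM -!expRD; congr (expR _)%:E.
  by field; rewrite gt_eqF.
rewrite ge0_integralZl ?lee_fin ?expR_ge0//; last 2 first.
- by apply/measurable_EFinP; exact: measurable_shift_density.
- by move=> x _; rewrite lee_fin expR_ge0.
rewrite -[RHS]mule1; congr (_ * _)%E.
transitivity (\int[normal_prob 0 s]_x
    ((cst 1 x) * (shift_density s (c + c') x)%:E))%E.
  by apply: eq_integral => x _; rewrite mul1e.
rewrite -ge0_integral_normal_shift// integral_cst// mul1e.
exact: probability_setT.
Qed.

(** Shifts with disjoint supports have uncorrelated likelihood ratios: each of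
    the pairs with k <> l contributes 1 to the second moment of the mixture, and
    each diagonal pair at most exp(V), for a total of 1 + exp(V) / #|J|. The
    number of alternatives may thus grow like the exponential of the squared
    length of the shifts, which is where the logarithm of the rate comes from. *)
Lemma shift_test (N : nat) (J : finType) (v : J -> 'I_N -> R) (s V C : R)
    (B : set (N.-tuple (measurableTypeR R))) : 0 < s -> (0 < #|J|)%N ->
  (forall k l i, k != l -> v k i * v l i = 0) ->
  (forall k, \sum_i v k i ^+ 2 <= V * s ^+ 2) ->
  2 <= C -> 1 + expR V / #|J|%:R <= C -> measurable B ->
  ((C^-1)%:E <= iid (normal_prob 0 s) N B + (#|J|%:R^-1)%:E *
    \sum_k iid (normal_prob 0 s) N
      ((fun w => [tuple (tnth w i + v k i)%R | i < N]) @^-1` ~` B))%E.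
Proof.
move=> s0 J0 v_orth v_le C2 CV mB.
have J0' : 0 < #|J|%:R :> R by rewrite ltr0n.
apply: (@iid_mixture_test _ (measurableTypeR R) R (normal_prob 0 s) N J
  (fun k i x => x + v k i) (fun k i => shift_density s (v k i))
  _ _ _ _ (fun k l => if k == l then expR V else 1)) => //.
- by move=> k i; exact: measurable_funD.
- by move=> k i; exact: measurable_shift_density.
- by move=> k i x; exact: expR_ge0.
- by move=> k i g mg g0; exact: ge0_integral_normal_shift.
- move=> k l; under eq_bigr => i _ do rewrite integral_shift_densityM//.
  rewrite prodEFin lee_fin -expR_sum; case: eqVneq => [<-|kl]; last first.
    by rewrite big1 ?expR0// => i _; rewrite v_orth// mul0r.
  rewrite ler_expR -mulr_suml ler_pdivrMr ?exprn_gt0//.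
  by under eq_bigr do rewrite -expr2.
- apply: (@le_trans _ _ (\sum_(k : J) (expR V + #|J|%:R))).
    apply: ler_sum => k _; rewrite (bigD1 k)//= eqxx lerD2l.
    apply: (@le_trans _ _ (\sum_(l : J | l != k) 1)).
      by apply: ler_sum => l lk; rewrite eq_sym (negbTE lk).
    by rewrite sumr_const ler_nat max_card.
  rewrite sumr_const -[leLHS]mulr_natr expr2 mulrA ler_wpM2r ?ler0n//.
  rewrite -ler_pdivrMr// mulrDl divff ?gt_eqF//.
  by rewrite addrC.
Qed.

Lemma bernoulli_ineq (x : R) n : 0 <= x <= 1 -> 1 - n%:R * x <= (1 - x) ^+ n.
Proof.
move=> /andP[x0 x1]; elim: n => [|n IHn]; first by rewrite mul0r subr0 expr0.
rewrite exprS; apply: (@le_trans _ _ ((1 - x) * (1 - n%:R * x))).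
  rewrite -subr_ge0 (_ : _ - _ = n%:R * x ^+ 2); last by rewrite -natr1; ring.
  by rewrite mulr_ge0// sqr_ge0.
by rewrite ler_wpM2l// subr_ge0.
Qed.

(** The density of N(0, s^2) with respect to N(0, 1). *)
Definition scale_density (s x : R) : R := s^-1 * expR (x ^+ 2 / 2 - x ^+ 2 / (2 * s ^+ 2)).

Lemma measurable_scale_density s : measurable_fun setT (scale_density s).
Proof.
apply: measurable_funM => //; apply: measurableT_comp => //.
by apply: measurable_funB; apply: measurable_funM => //; exact: measurable_funX.
Qed.

Lemma ge0_integral_normal_scale (s : R) (h : R -> \bar R) : 0 < s ->
  measurable_fun setT h -> (forall x, 0 <= h x)%E ->
  (\int[normal_prob 0 1]_x h (s * x)%R =
   \int[normal_prob 0 1]_x (h x * (scale_density s x)%:E))%E.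
Proof.
move=> s0 mh h0.
under eq_integral => x _ do rewrite -[(s * x)%R]addr0.
rewrite (ge0_integral_normal_affine 0 0 (lt0r_neq0 s0) (oner_neq0 R) mh h0).
rewrite mulr0 add0r mulr1 (gtr0_norm s0).
apply: ge0_integral_normal_change => //.
- exact: measurable_scale_density.
- by move=> x; rewrite mulr_ge0 ?expR_ge0// invr_ge0 ltW.
move=> x; rewrite !normal_pdfE ?gt_eqF// -[in LHS](mulr1 s) normal_peakM//.
rewrite /scale_density -!mulrA; congr (_ * _).
rewrite [RHS]mulrCA; congr (_ * _).
rewrite -expRD; congr expR; by field; rewrite gt_eqF.
Qed.

(** The square of the likelihood ratio times the standard normal density is
    again Gaussian, with standard deviation s / sqrt(2 - s^2), up to the factor
    on the right-hand side. *)
Lemma integral_scale_density_sqr (s : R) : 0 < s -> s ^+ 2 < 2 ->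
  (\int[normal_prob 0 1]_x (scale_density s x * scale_density s x)%:E =
   ((s * Num.sqrt (2 - s ^+ 2))^-1)%:E)%E.
Proof.
move=> s0 s2; pose q := Num.sqrt (2 - s ^+ 2).
have q0 : 0 < q by rewrite sqrtr_gt0 subr_gt0.
have q2 : q ^+ 2 = 2 - s ^+ 2 by rewrite sqr_sqrtr// subr_ge0 ltW.
rewrite ge0_integral_normal_prob//; last 2 first.
- apply/measurable_EFinP; apply: measurable_funM; exact: measurable_scale_density.
- by move=> x; rewrite lee_fin -expr2 sqr_ge0.
transitivity (\int[lebesgue_measure]_x
  ((s * q)^-1%:E * (normal_pdf 0 (s / q) x)%:E))%E; last first.
  rewrite ge0_integralZl//; last 3 first.
  - by apply/measurable_EFinP; exact: measurable_normal_pdf.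
  - by move=> x _; rewrite lee_fin normal_pdf_ge0.
  - by rewrite lee_fin invr_ge0 mulr_ge0// ltW.
  by rewrite integral_normal_pdf mule1.
apply: eq_integral => x _; rewrite -!EFinM; congr EFin.
rewrite !normal_pdfE ?gt_eqF ?divr_gt0// -[in RHS](mulr1 (s / q)).
rewrite normal_peakM ?divr_gt0//.
have -> : normal_fun 0 (s / q * 1) x = expR (x ^+ 2 / 2 - x ^+ 2 / (2 * s ^+ 2)) ^+ 2
    * normal_fun 0 1 x.
  rewrite /normal_fun -expRM_natl -expRD; congr expR.
  have -> : (s / q * 1) ^+ 2 = s ^+ 2 / (2 - s ^+ 2).
    by rewrite mulr1 expr_div_n q2.
  field; rewrite gt_eqF// subr_eq0 gt_eqF//.
rewrite /scale_density; field; by rewrite !gt_eqF.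
Qed.

(** The constant 6 only has to be large enough for the second moment of the
    likelihood ratio of n coordinates to stay below 2. *)
Definition scale_factor (n : nat) : R := (6 * Num.sqrt n%:R)^-1.

(** With s = 1 + scale_factor n, the second moment of one likelihood ratio is
    1 / D with D^2 = 1 - (s^2 - 1)^2. As s^2 - 1 <= 3 / (6 sqrt n), D is at
    least 1 - 1 / (4 n), and Bernoulli's inequality bounds D^n below by 3/4. *)
Lemma scale_test (n : nat) (B : set (n.-tuple (measurableTypeR R))) :
  (0 < n)%N -> measurable B ->
  ((2^-1)%:E <= iid (normal_prob 0 (1:R)) n B +
    iid (normal_prob 0 (1:R)) n
      ((fun w => [tuple ((1 + scale_factor n) * tnth w i)%R | i < n]) @^-1` ~` B))%E.
Proof.
move=> n0 mB; set s := 1 + scale_factor n.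
have n0' : 1 <= n%:R :> R by rewrite ler1n.
have d2 : scale_factor n ^+ 2 = (36 * n%:R)^-1.
  by rewrite /scale_factor exprVn exprMn sqr_sqrtr//; congr (_ * _)^-1; ring.
have d0 : 0 < scale_factor n.
  by rewrite invr_gt0 mulr_gt0// sqrtr_gt0 (lt_le_trans _ n0').
have d1 : scale_factor n <= 6^-1.
  rewrite lef_pV2 ?posrE// ?mulr_gt0 ?sqrtr_gt0 ?(lt_le_trans _ n0')//.
  by rewrite ler_peMr// -[leLHS]sqrtr1 ler_wsqrtr.
set dl := scale_factor n in s d2 d0 d1 *.
have s0 : 0 < s by rewrite addr_gt0.
have s2 : s ^+ 2 < 2 by rewrite /s; nra.
pose D := s * Num.sqrt (2 - s ^+ 2).
have D0 : 0 < D by rewrite mulr_gt0// sqrtr_gt0 subr_gt0.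
have DE : D ^+ 2 = 1 - (s ^+ 2 - 1) ^+ 2.
  by rewrite exprMn sqr_sqrtr ?subr_ge0 ?(ltW s2)//; ring.
have D1 : D <= 1.
  by rewrite -(@ler_pXn2r _ 2)// ?nnegrE ?(ltW D0)// DE expr1n lerBlDr lerDl sqr_ge0.
have Dge : 1 - (4 * n%:R)^-1 <= D.
  apply: (@le_trans _ _ (D ^+ 2)); last by rewrite expr2 ler_piMl// ltW.
  rewrite DE lerD2l lerN2.
  have -> : (4 * n%:R)^-1 = 9 * dl ^+ 2.
    by rewrite d2; field; rewrite gt_eqF// (lt_le_trans _ n0').
  by rewrite /s; nra.
have Dn : 3 / 4 <= D ^+ n.
  apply: (@le_trans _ _ ((1 - (4 * n%:R)^-1) ^+ n)).
    apply: le_trans (bernoulli_ineq _ _); last first.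
      rewrite invr_ge0 mulr_ge0//= invf_le1 ?mulr_gt0 ?(lt_le_trans _ n0')//.
      by nra.
    rewrite (_ : n%:R * _ = 4^-1); first by lra.
    by field; rewrite gt_eqF// (lt_le_trans _ n0').
  rewrite lerXn2r ?nnegrE ?(ltW D0)// subr_ge0 invf_le1 ?mulr_gt0 ?(lt_le_trans _ n0')//.
  by nra.
have := @iid_mixture_test _ (measurableTypeR R) R (normal_prob 0 1) n 'I_1
  (fun k i x => s * x) (fun k i => scale_density s) _ _ _ _ (fun k l => D ^- n) 2 B.
rewrite !big_ord1 card_ord invr1 mul1e; apply => //.
- by move=> k i; exact: measurable_funM.
- by move=> k i; exact: measurable_scale_density.
- by move=> k i x; rewrite mulr_ge0 ?expR_ge0// invr_ge0 ltW.
- by move=> k i g mg g0; exact: ge0_integral_normal_scale.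
- move=> k l; under eq_bigr => i _ do rewrite integral_scale_density_sqr//.
  by rewrite prodEFin lee_fin prodr_const card_ord exprVn.
- rewrite expr1n mulr1 invf_ple ?posrE ?exprn_gt0//.
  by lra.
Qed.

End gaussian_tests.

(** * Smooth bumps with compact support *)

Section derivative_criteria.
Context {R : realType}.

Lemma is_derive_cvg (V : normedModType R) (f : V -> R) (v u : V) (l : R) :
  h^-1 * (f (h *: u + v) - f v) @[h --> (0:R)^'] --> l -> is_derive v u f l.
Proof.
move=> cvgf; apply: DeriveDef; first by apply/cvg_ex; exists l.
exact/cvg_lim.
Qed.

(** A uniform quadratic remainder handles functions that are defined by cases,
    without distinguishing one-sided derivatives. *)
Lemma is_derive_quadratic_remainder (f : R -> R) (t l C : R) :
  (forall h, `|f (h + t) - f t - l * h| <= C * h ^+ 2) -> is_derive t 1 f l.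
Proof.
move=> fC; apply: is_derive_cvg; apply/cvgrPdist_le => e e0.
have C0 : 0 <= C by rewrite -[C]mulr1 -(expr1n _ 2) (le_trans _ (fC 1)).
have C1 : 0 < C + 1 by rewrite ltr_wpDl.
have d0 : 0 < e / (C + 1) by rewrite divr_gt0.
near=> h.
have h0 : h != 0 by near: h; exact: nbhs_dnbhs_neq.
have hd : `|h| <= e / (C + 1).
  near: h; apply: nbhs_dnbhs; apply/nbhs_ballP; exists (e / (C + 1)) => //= h.
  by rewrite /ball/= sub0r normrN => /ltW.
have h0' : 0 < `|h| by rewrite normr_gt0.
rewrite scaler1 -(ler_pM2l h0') -normrM mulrBr mulVKf// distrC [h * l]mulrC.
apply: (le_trans (fC h)); rewrite -real_normK ?num_real// expr2 mulrCA ler_wpM2l//.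
apply: (@le_trans _ _ ((C + 1) * (e / (C + 1)))).
  by apply: ler_pM => //; rewrite lerDl.
by rewrite mulrC divfK ?gt_eqF.
Unshelve. all: by end_near.
Qed.

(** Reduces a directional derivative, in particular a partial derivative of
    f x * f y, to a derivative on the line. *)
Lemma is_derive_section (V : normedModType R) (f : V -> R) (v u : V) (phi : R -> R) (t k l : R) :
  (forall h, f (h *: u + v) - f v = k * (phi (h + t) - phi t)) ->
  is_derive t 1 phi l -> is_derive v u f (k * l).
Proof.
move=> fE [dphi <-]; apply: is_derive_cvg.
under eq_fun do rewrite fE mulrCA.
apply: cvgMr.
have := dphi; rewrite /derivable /= => cv.
have -> : (fun h => h^-1 * (phi (h + t) - phi t)) =
          (fun h => h^-1 *: (phi (h *: 1 + t) - phi t)).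
  by apply/funext => h; rewrite scaler1.
exact: cv.
Qed.

Lemma is_derive_affine (f : R -> R) (a b t l : R) :
  is_derive (a * t + b) 1 f l -> is_derive t 1 (fun x => f (a * x + b)) (l * a).
Proof.
move=> df; apply: (@is_derive1_comp R f (fun x => a * x + b)) => //.
apply: (@is_derive_quadratic_remainder _ _ _ 0) => h.
by rewrite (_ : _ - _ = 0) ?normr0 ?mul0r//; ring.
Qed.

End derivative_criteria.

Section bump.
Context {R : realType}.
Implicit Types (p : {poly R}) (t : R).

Definition clamp (t : R) : R := Num.min 1 (Num.max 0 t).

Lemma clamp_itv t : 0 <= clamp t <= 1.
Proof. by rewrite /clamp le_min ge_min le_max !lexx ler01. Qed.

Lemma clamp_id t : 0 <= t <= 1 -> clamp t = t.
Proof. by move=> /andP[t0 t1]; rewrite /clamp max_r// min_r. Qed.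

Lemma clamp_le0 t : t <= 0 -> clamp t = 0.
Proof. by move=> t0; rewrite /clamp max_l// min_r// ler01. Qed.

Lemma clamp_ge1 t : 1 <= t -> clamp t = 1.
Proof. by move=> t1; rewrite /clamp max_r ?min_l// (le_trans ler01). Qed.

Lemma clampP t : [\/ clamp t = 0 /\ t <= 0, clamp t = 1 /\ 1 <= t |
  clamp t = t /\ (0 <= t /\ t <= 1)].
Proof.
have [t0|t0] := leP t 0; first by constructor 1; rewrite clamp_le0.
have [t1|t1] := leP 1 t; first by constructor 2; rewrite clamp_ge1.
by constructor 3; rewrite clamp_id ?(ltW t0) ?ltW.
Qed.

Lemma clamp_lipschitz t s : `|clamp t - clamp s| <= `|t - s|.
Proof.
wlog ts : t s / t <= s.
  move=> H; have [/H//|/ltW/H] := leP t s.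
  by rewrite distrC [leRHS]distrC.
rewrite [leRHS]distrC [leRHS]ger0_norm ?subr_ge0// ler_norml.
by case: (clampP t) => -[-> ?]; case: (clampP s) => -[-> ?]; apply/andP; split; lra.
Qed.

Lemma poly_bounded p : exists2 K, 0 <= K & forall t, 0 <= t <= 1 -> `|p.[t]| <= K.
Proof.
exists (\sum_(i < size p) `|p`_i|); first by apply: sumr_ge0.
move=> t /andP[t0 t1]; rewrite horner_coef; apply: le_trans (ler_norm_sum _ _ _) _.
apply: ler_sum => i _; rewrite normrM ler_piMr// normrX ger0_norm//.
exact: exprn_ile1.
Qed.

Lemma poly_mean_value p a b : exists c,
  [/\ `|c - a| <= `|b - a|, (0 <= a <= 1 -> 0 <= b <= 1 -> 0 <= c <= 1) &
      p.[b] - p.[a] = p^`().[c] * (b - a)].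
Proof.
have cp x y : {within `[x, y], continuous (horner p)}.
  by apply: continuous_subspaceT => z; exact: continuous_horner.
have [ab|/ltW ba] := leP a b.
- have [c] := MVT_segment ab (fun x _ => is_derive_poly p x) (cp a b).
  rewrite in_itv/= => /andP[ac cb] E; exists c; split => //.
    by rewrite !ger0_norm ?subr_ge0// lerD2r.
  by move=> /andP[a0 _] /andP[_ b1]; rewrite (le_trans a0 ac) (le_trans cb b1).
- have [c] := MVT_segment ba (fun x _ => is_derive_poly p x) (cp b a).
  rewrite in_itv/= => /andP[bc ca] E; exists c; split => //.
  + by rewrite !ler0_norm ?subr_le0// lerN2 lerD2r.
  + by move=> /andP[_ a1] /andP[b0 _]; rewrite (le_trans b0 bc) (le_trans ca a1).
  + by rewrite -opprB E -mulrN opprB.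
Qed.

Lemma poly_lipschitz p K : (forall t, 0 <= t <= 1 -> `|p^`().[t]| <= K) ->
  forall t s, 0 <= t <= 1 -> 0 <= s <= 1 -> `|p.[t] - p.[s]| <= K * `|t - s|.
Proof.
move=> pK t s t01 s01; have [c [_ c01 ->]] := poly_mean_value p s t.
by rewrite normrM ler_wpM2r// pK// c01.
Qed.

(** Composing with the projection onto [0, 1] makes a polynomial constant
    outside of [0, 1]; this is differentiable at the corners 0 and 1 because the
    derivative of the polynomial vanishes there. In the expansion at t, the
    error due to the projection is nonzero only if t is within distance |h| of a
    corner, where the derivative is itself O(|h|). *)
Lemma is_derive_poly_clamp p t : p^`().[0] = 0 -> p^`().[1] = 0 ->
  is_derive t 1 (fun x => p.[clamp x]) p^`().[clamp t].
Proof.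
move=> p0 p1.
have [K K0 ppK] := poly_bounded p^`()^`().
apply: (@is_derive_quadratic_remainder _ _ _ _ (2 * K)) => h.
set a := clamp t; set b := clamp (h + t).
have a01 : 0 <= a <= 1 := clamp_itv t.
have b01 : 0 <= b <= 1 := clamp_itv (h + t).
have ab : `|b - a| <= `|h|.
  by apply: le_trans (clamp_lipschitz _ _) _; rewrite addrK.
have pL := poly_lipschitz ppK.
have taylor : `|p.[b] - p.[a] - p^`().[a] * (b - a)| <= K * h ^+ 2.
  have [c [ca c01 ->]] := poly_mean_value p a b.
  rewrite -mulrBl normrM -real_normK ?num_real// expr2 mulrA.
  apply: ler_pM => //; apply: le_trans (pL _ _ (c01 a01 b01) a01) _.
  by rewrite ler_wpM2l// (le_trans ca).
(* the projection moves t + h only if a corner lies between t and t + h *)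
have corner : `|p^`().[a] * (b - a - h)| <= K * h ^+ 2.
  have Kh : 0 <= K * h ^+ 2 by rewrite mulr_ge0// sqr_ge0.
  have [t0|t0] := leP t 0; first by rewrite /a clamp_le0// p0 mul0r normr0.
  have [t1|t1] := leP 1 t; first by rewrite /a clamp_ge1// p1 mul0r normr0.
  have aE : a = t by apply: clamp_id; rewrite !ltW.
  have [th0|th0] := leP (h + t) 0.
    rewrite /b clamp_le0// normrM -real_normK ?num_real// expr2 mulrA.
    have := pL a 0 a01; rewrite p0 !subr0 lexx ler01 => /(_ isT) pa.
    have hE : `|h| = - h by rewrite ltr0_norm//; lra.
    apply: ler_pM => //; last by rewrite aE hE ler_norml; lra.
    by apply: le_trans pa _; rewrite ler_wpM2l// hE aE gtr0_norm//; lra.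
  have [th1|th1] := leP 1 (h + t).
    rewrite /b clamp_ge1// normrM -real_normK ?num_real// expr2 mulrA.
    have := pL a 1 a01; rewrite p1 subr0 lexx ler01 => /(_ isT) pa.
    have hE : `|h| = h by rewrite gtr0_norm//; lra.
    apply: ler_pM => //; last by rewrite aE hE ler_norml; lra.
    by apply: le_trans pa _; rewrite ler_wpM2l// hE aE ltr0_norm//; lra.
  rewrite /b clamp_id ?(ltW th0) ?(ltW th1)// aE.
  by rewrite (_ : _ - h = 0) ?mulr0 ?normr0//; ring.
have -> : p.[b] - p.[a] - p^`().[a] * h =
  (p.[b] - p.[a] - p^`().[a] * (b - a)) + p^`().[a] * (b - a - h) by ring.
apply: le_trans (ler_normD _ _) _.
by rewrite -mulrA mulr_natl mulr2n lerD.
Qed.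

Lemma deriv_exp_root (c : R) (m : nat) (r : {poly R}) :
  exists r', (('X - c%:P) ^+ m.+1 * r)^`() = ('X - c%:P) ^+ m * r'.
Proof.
exists (r *+ m.+1 + ('X - c%:P) * r^`()).
rewrite derivM deriv_exp derivXsubC mulrDr mul1r/=; congr (_ + _).
  by rewrite mulrnAl mulrnAr.
by rewrite exprSr mulrA.
Qed.

Lemma derivn_exp_root (c : R) (m i : nat) (r : {poly R}) : (i <= m)%N ->
  exists r', (('X - c%:P) ^+ m * r)^`(i) = ('X - c%:P) ^+ (m - i) * r'.
Proof.
elim: i => [|i IHi] im; first by exists r; rewrite subn0.
have [r' E] := IHi (ltnW im); rewrite derivnS E -(subnSK im).
exact: deriv_exp_root.
Qed.

(** The polynomial (4 X (1 - X))^m, with value 1 at 1/2 and roots of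
    multiplicity m at 0 and 1. *)
Definition bump_poly (m : nat) : {poly R} :=
  (('X - 0%:P) ^+ m * ('X - 1%:P) ^+ m) * ((- 4) ^+ m)%:P.

Lemma bump_poly_root m i : (i < m)%N ->
  (bump_poly m)^`(i).[0] = 0 /\ (bump_poly m)^`(i).[1] = 0.
Proof.
move=> im; split.
- have [r] := derivn_exp_root 0 (('X - 1%:P) ^+ m * ((- 4) ^+ m)%:P) (ltnW im).
  rewrite mulrA => ->.
  by rewrite hornerM horner_exp hornerXsubC subrr expr0n subn_eq0 leqNgt im mul0r.
- have [r] := derivn_exp_root 1 (('X - 0%:P) ^+ m * ((- 4) ^+ m)%:P) (ltnW im).
  rewrite mulrCA mulrA => ->.
  by rewrite hornerM horner_exp hornerXsubC subrr expr0n subn_eq0 leqNgt im mul0r.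
Qed.

(** The i-th derivative of a bump supported in [0, 1], for i < m. *)
Definition bump (m i : nat) (t : R) : R := (bump_poly m)^`(i).[clamp t].

Lemma is_derive_bump m i t : (i.+1 < m)%N ->
  is_derive t 1 (bump m i) (bump m i.+1 t).
Proof.
move=> im; have [q0 q1] := bump_poly_root im.
by rewrite /bump derivnS; apply: is_derive_poly_clamp; rewrite -derivnS.
Qed.

Lemma bump_out m t : (0 < m)%N -> ~~ (0 < t < 1) -> bump m 0 t = 0.
Proof.
move=> m0; have [q0 q1] := bump_poly_root m0.
rewrite negb_and -!leNgt /bump => /orP[t0|t1].
  by rewrite clamp_le0.
by rewrite clamp_ge1.
Qed.

Lemma bump_mid m : bump m 0 2^-1 = 1.
Proof.
rewrite /bump clamp_id; last by apply/andP; split; lra.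
rewrite derivn0 /bump_poly !hornerE -!exprMn.
by rewrite (_ : _ * _ = 1) ?expr1n//; lra.
Qed.

Lemma bump_bounded m : exists2 K, 1 <= K & forall i, (i <= m)%N ->
  (forall t, `|bump m i t| <= K) /\
  (forall t s, `|bump m i t - bump m i s| <= K * `|t - s|).
Proof.
have [K KP] : exists K : nat -> R, forall i, 0 <= K i /\
    forall t, 0 <= t <= 1 -> `|(bump_poly m)^`(i).[t]| <= K i.
  have /choice[K KP] : forall i, exists K, 0 <= K /\
      forall t, 0 <= t <= 1 -> `|(bump_poly m)^`(i).[t]| <= K.
    by move=> i; have [K K0 KP] := poly_bounded ((bump_poly m)^`(i)); exists K.
  by exists K.
have K0 i : 0 <= K i by have [] := KP i.
exists (1 + \sum_(i < m.+2) K i); first by rewrite lerDl sumr_ge0.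
have Kle i : (i < m.+2)%N -> K i <= 1 + \sum_(i < m.+2) K i.
  move=> im; rewrite (bigD1 (Ordinal im))//= addrCA lerDl addr_ge0//.
  exact: sumr_ge0.
move=> i im; split => [t|t s].
  by apply: le_trans (Kle i _); [apply: (KP i).2; exact: clamp_itv|exact: leqW].
apply: (@le_trans _ _ (K i.+1 * `|clamp t - clamp s|)).
  apply: poly_lipschitz; [|exact: clamp_itv|exact: clamp_itv].
  by move=> x x01; rewrite -derivnS; apply: (KP i.+1).2.
by apply: ler_pM => //; [exact: Kle|exact: clamp_lipschitz].
Qed.

End bump.

(** * Hölder bounds for rank-one kernels *)

Section strict_floor_theory.
Context {R : realType}.
Implicit Types g : R.

Lemma strict_floor_lt g : 0 < g -> (strict_floor g)%:R < g.
Proof.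
move=> g0; rewrite /strict_floor.
elim/big_ind : _ => // x y xg yg.
by rewrite /maxn; case: ifP.
Qed.

Lemma strict_floor_ge g : 0 < g -> g <= (strict_floor g).+1%:R.
Proof.
move=> g0; rewrite leNgt; apply/negP => kg.
have kt : ((strict_floor g).+1 < (Num.truncn g).+1)%N.
  by rewrite ltnS truncn_ge_nat ?ltW.
have := @leq_bigmax_cond _ (fun k : 'I_(Num.truncn g).+1 => (k%:R < g))
  (fun k => k : nat) (Ordinal kt) kg.
by rewrite -/(strict_floor g) /= ltnn.
Qed.

End strict_floor_theory.

Section holder_profile.
Context {R : realType}.
Variable g : R.
Hypothesis g_gt0 : 0 < g.
Local Notation k := (strict_floor g).

(** F i stands for the i-th derivative of F 0. *)
Definition holder_profile (K : R) (F : nat -> R -> R) : Prop :=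
  [/\ forall i (t : R), (i < k)%N -> is_derive t 1 (F i) (F i.+1 t),
      forall i, (i <= k)%N -> continuous (F i),
      forall i t, (i <= k)%N -> `|F i t| <= K &
      forall i t s, (i <= k)%N -> `|F i t - F i s| <= K * `|t - s| `^ (g - k%:R)].

(** The derivative of order (a, b) of the kernel is c times F a x * F b y. For
    the Hölder seminorm, an increment of this product splits into one increment
    in each variable, each of them bounded by K * K; adding the bound on the
    derivatives gives the constant 3. *)
Lemma holder_class_rank_one (L K c : R) (F : nat -> R -> R) :
  holder_profile K F -> 0 <= c -> 3 * c * K ^+ 2 <= L ->
  holder_class g L (fun v => c * (F 0%N v.1 * F 0%N v.2)).
Proof.
case=> dF cF bF hF c0 cKL.
have K0 : 0 <= K by apply: le_trans (bF 0%N 0 _).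
exists (fun a b v => c * (F a v.1 * F b v.2)); split.
  split => //.
  - move=> a b abk; apply: continuous_subspaceT => v.
    apply: cvgMr; apply: cvgM.
    + apply: (cvg_comp fst (F a)); first exact: cvg_fst.
      by apply: cF; rewrite (leq_trans _ abk)// leq_addr.
    + apply: (cvg_comp snd (F b)); first exact: cvg_snd.
      by apply: cF; rewrite (leq_trans _ abk)// leq_addl.
  - move=> a b v abk _; split.
    + have -> : c * (F a.+1 v.1 * F b v.2) = (c * F b v.2) * F a.+1 v.1 by ring.
      apply: (@is_derive_section _ _ _ _ _ (F a) v.1).
        by move=> h /=; rewrite scaler0 add0r scaler1; ring.
      by apply: dF; rewrite (leq_ltn_trans _ abk)// leq_addr.
    + have -> : c * (F a v.1 * F b.+1 v.2) = (c * F a v.1) * F b.+1 v.2 by ring.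
      apply: (@is_derive_section _ _ _ _ _ (F b) v.2).
        by move=> h /=; rewrite scaler0 add0r scaler1; ring.
      by apply: dF; rewrite (leq_ltn_trans _ abk)// leq_addl.
rewrite /holder_norm.
apply: (@le_trans _ _ ((c * K ^+ 2)%:E + (2 * c * K ^+ 2)%:E)%E); last first.
  by rewrite -EFinD lee_fin; apply: le_trans cKL; lra.
apply: leeD.
  apply: bigmax_le; first by rewrite lee_fin mulr_ge0// sqr_ge0.
  move=> [a b] /= abk; apply: ge_ereal_sup => _ [v _ <-]; rewrite lee_fin.
  rewrite normrM (ger0_norm c0) ler_wpM2l// normrM expr2 ler_pM//.
    by apply: bF; rewrite (leq_trans _ abk)// leq_addr.
  by apply: bF; rewrite (leq_trans _ abk)// leq_addl.
apply: bigmax_le; first by rewrite lee_fin !mulr_ge0.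
move=> [a b] /= /eqP abk; apply: ge_ereal_sup => _ [[v w] /= [_ _ vw] <-].
have ak : (a <= k)%N by rewrite (leq_trans (leq_addr b a))// abk.
have bk : (b <= k)%N by rewrite (leq_trans (leq_addl a b))// abk.
have N0 : 0 < `|v - w| by rewrite normr_gt0 subr_eq0.
rewrite lee_fin ler_pdivrMr ?powR_gt0//.
have b0 : 0 <= g - k%:R by rewrite subr_ge0 ltW// strict_floor_lt.
have le1 : `|v.1 - w.1| `^ (g - k%:R) <= `|v - w| `^ (g - k%:R).
  by rewrite ge0_ler_powR ?nnegrE// [leRHS]prod_normE/= le_max lexx.
have le2 : `|v.2 - w.2| `^ (g - k%:R) <= `|v - w| `^ (g - k%:R).
  by rewrite ge0_ler_powR ?nnegrE// [leRHS]prod_normE/= le_max lexx orbT.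
rewrite -mulrBr normrM (ger0_norm c0) -!mulrA mulrCA ler_wpM2l//.
have -> : F a v.1 * F b v.2 - F a w.1 * F b w.2 =
  (F a v.1 - F a w.1) * F b v.2 + F a w.1 * (F b v.2 - F b w.2) by ring.
apply: le_trans (ler_normD _ _) _; rewrite [leRHS]mulr_natl mulr2n !normrM.
rewrite lerD//.
  rewrite mulrC; apply: ler_pM => //; first exact: bF.
  by apply: le_trans (hF _ _ _ ak) _; rewrite ler_wpM2l.
apply: ler_pM => //; first exact: bF.
by apply: le_trans (hF _ _ _ bk) _; rewrite ler_wpM2l.
Qed.

Lemma holder_profile_cst (b K : R) : 0 <= b <= K ->
  holder_profile K (fun i => cst (if i == 0%N then b else 0)).
Proof.
move=> /andP[b0 bK].
have K0 := le_trans b0 bK.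
split.
- by move=> i t _ /=; exact: is_derive_cst.
- by move=> i _; exact: cst_continuous.
- by move=> i t _ /=; case: ifP => _; rewrite ?normr0// ger0_norm.
- by move=> i t s _ /=; rewrite subrr normr0 mulr_ge0// powR_ge0.
Qed.

Lemma lipschitz_continuous (f : R -> R) (K : R) :
  (forall t s, `|f t - f s| <= K * `|t - s|) -> continuous f.
Proof.
move=> fK t; apply/cvgrPdist_le => e e0.
have K0 : 0 <= K.
  by have := fK 1 0; rewrite subr0 normr1 mulr1; apply: le_trans.
have K1 : 0 < K + 1 by rewrite ltr_wpDl.
near=> s.
apply: le_trans (fK _ _) _.
have ts : `|t - s| <= e / (K + 1).
  near: s; apply/nbhs_ballP; exists (e / (K + 1)) => /=; first by rewrite divr_gt0.
  by move=> s; rewrite /ball/= => /ltW.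
apply: (@le_trans _ _ ((K + 1) * (e / (K + 1)))).
  by apply: ler_pM => //; rewrite lerDl.
by rewrite mulrC divfK ?gt_eqF.
Unshelve. all: by end_near.
Qed.

(** The constant b plus a bump of width h and height b * dl that starts at u,
    with its derivatives (only the derivative of order 0 contains b). *)
Definition bump_profile (b dl h u : R) (i : nat) (t : R) : R :=
  (if i == 0%N then b else 0) + b * dl * h ^- i * bump k.+2 i (h^-1 * t + (- u / h)).

(** A derivative of order i <= k costs a factor h^(-i), which dl <= h^g
    absorbs. For the Hölder bound, with r = |t - s| / h, an increment of the
    rescaled bump is at most 2 K min(1, r) <= 2 K r^(g - k) because g - k lies in
    ]0, 1], and the powers of h that remain are at most h^(g - k). *)
Lemma bump_profile_holder (b dl h u K : R) : 0 <= b -> 0 < h <= 1 ->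
  0 <= dl <= h `^ g -> 1 <= K ->
  (forall i, (i <= k.+2)%N -> (forall t, `|bump k.+2 i t| <= K) /\
    (forall t s : R, `|bump k.+2 i t - bump k.+2 i s| <= K * `|t - s|)) ->
  holder_profile (b * (1 + 2 * K)) (bump_profile b dl h u).
Proof.
move=> b0 /andP[h0 h1] /andP[dl0 dlh] K1 bumpK.
have K0 : 0 <= K by apply: le_trans K1.
have gk := strict_floor_lt g_gt0; have gk1 := strict_floor_ge g_gt0.
have lek i : (i <= k)%N -> (i <= k.+2)%N by move=> ik; rewrite ltnW// ltnW.
(* dl <= h^g and h <= 1 *)
have scale i : (i <= k)%N -> dl * h ^- i <= h `^ (g - k%:R).
  move=> ik; rewrite -powR_invn ?(ltW h0)//.
  apply: (@le_trans _ _ (h `^ g * h `^ (- i%:R))); first by rewrite ler_wpM2r// powR_ge0.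
  rewrite -powRD; last by rewrite (gt_eqF h0) implybT.
  by rewrite ger_powR ?h0// lerD2l lerN2 ler_nat.
have scale1 i : (i <= k)%N -> dl * h ^- i <= 1.
  move=> ik; apply: le_trans (scale i ik) _.
  rewrite -[leRHS](powRr0 h) ger_powR ?h0// subr_ge0 ltW//.
have scale0 i : 0 <= dl * h ^- i by rewrite mulr_ge0// invr_ge0 exprn_ge0// ltW.
have hol i t s : (i <= k)%N -> `|bump_profile b dl h u i t - bump_profile b dl h u i s| <=
    b * (2 * K) * `|t - s| `^ (g - k%:R).
  move=> ik; rewrite /bump_profile.
  set x := _ + - u / h; set y := _ + - u / h.
  have xy : `|x - y| = `|t - s| / h.
    have -> : x - y = (t - s) / h by rewrite /x /y; ring.
    by rewrite normrM [`|h^-1|]gtr0_norm// invr_gt0.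
  set r := `|t - s| / h.
  have r0 : 0 <= r by rewrite divr_ge0// ltW.
  have -> : `|t - s| = h * r by rewrite /r mulrC divfK// gt_eqF.
  rewrite powRM ?(ltW h0)//.
  have B : `|bump k.+2 i x - bump k.+2 i y| <= 2 * K * r `^ (g - k%:R).
    have [r1|r1] := leP r 1.
      apply: (@le_trans _ _ (K * r)).
        by rewrite /r -xy; apply: (bumpK i (lek _ ik)).2.
      have [->|rn0] := eqVneq r 0; first by rewrite mulr0 !mulr_ge0// powR_ge0.
      have rp : 0 < r by rewrite lt_neqAle eq_sym rn0.
      have : r <= r `^ (g - k%:R).
        by apply: ger1_powR; rewrite ?rp//; rewrite -natr1 in gk1; lra.
      have := powR_ge0 r (g - k%:R); nra.
    apply: (@le_trans _ _ (2 * K)).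
      rewrite mulrDl mul1r (le_trans (ler_normB _ _))// lerD//;
        exact: (bumpK i (lek _ ik)).1.
    rewrite ler_peMr ?mulr_ge0//.
    by rewrite -[leLHS](powRr0 r) ler_powR ?(ltW r1)// subr_ge0 ltW.
  have -> : (if i == 0%N then b else 0) + b * dl * h ^- i * bump k.+2 i x -
    ((if i == 0%N then b else 0) + b * dl * h ^- i * bump k.+2 i y) =
    b * ((dl * h ^- i) * (bump k.+2 i x - bump k.+2 i y)) by ring.
  rewrite normrM (ger0_norm b0) -[leRHS]mulrA ler_wpM2l// normrM (ger0_norm (scale0 i)).
  by rewrite mulrCA ler_pM// scale.
split.
- move=> i t ik.
  have dB : is_derive (h^-1 * t + (- u / h)) 1 (bump k.+2 i)
      (bump k.+2 i.+1 (h^-1 * t + (- u / h))).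
    by apply: is_derive_bump; exact: leqW ik.
  have -> : bump_profile b dl h u i.+1 t = (b * dl * h ^- i) *
      (bump k.+2 i.+1 (h^-1 * t + (- u / h)) * h^-1).
    by rewrite /bump_profile/= add0r exprSr invfM; ring.
  have dA := is_derive_affine dB.
  apply: (@is_derive_section _ _ _ _ _
    (fun x => bump k.+2 i (h^-1 * x + - u / h)) t) => // x.
  by rewrite scaler1 /bump_profile; ring.
- move=> i ik; apply: (@lipschitz_continuous _ (b * dl * h ^- i * (K / h))) => t s.
  rewrite /bump_profile.
  set x := _ + - u / h; set y := _ + - u / h.
  have xy : `|x - y| = `|t - s| / h.
    have -> : x - y = (t - s) / h by rewrite /x /y; ring.
    by rewrite normrM [`|h^-1|]gtr0_norm// invr_gt0.
  have -> : (if i == 0%N then b else 0) + b * dl * h ^- i * bump k.+2 i x -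
    ((if i == 0%N then b else 0) + b * dl * h ^- i * bump k.+2 i y) =
    b * (dl * h ^- i) * (bump k.+2 i x - bump k.+2 i y) by ring.
  rewrite normrM (ger0_norm (mulr_ge0 b0 (scale0 i))).
  have -> : b * dl * h ^- i * (K / h) * `|t - s| = b * (dl * h ^- i) * (K * `|x - y|).
    by rewrite xy; ring.
  rewrite (ler_wpM2l (mulr_ge0 b0 (scale0 i)))//.
  exact: (bumpK i (lek _ ik)).2.
- move=> i t ik.
  rewrite /bump_profile mulrDr mulr1 (le_trans (ler_normD _ _))// lerD//.
    by case: ifP => _; rewrite ?normr0// ger0_norm.
  rewrite -!mulrA normrM (ger0_norm b0) ler_wpM2l// mulrA normrM (ger0_norm (scale0 i)).
  apply: (@le_trans _ _ (1 * K)); last by lra.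
  by rewrite ler_pM// ?scale1//; apply: (bumpK i (lek _ ik)).1.
- move=> i t s ik; apply: le_trans (hol i t s ik) _.
  by rewrite ler_wpM2r ?powR_ge0// ler_wpM2l// lerDr.
Qed.

End holder_profile.

(** * Independence in product spaces and moments of the normal law *)

Section iid_independence.
Context d (T : measurableType d) (R : realType) (P : probability T R).

(** Mutual independence of the coordinates, indexed by a type I in bijection
    with the coordinates so that the errors can be indexed by pairs (i, j). *)
Lemma iid_coordinates (N : nat) (I : finType) (r : I -> 'I_N) (r' : 'I_N -> I)
    (J : {set I}) (A : I -> set T) : cancel r r' -> cancel r' r ->
  (forall i, i \in J -> measurable (A i)) ->
  iid P N (\bigcap_(i in [set` J]) ((fun w => tnth w (r i)) @^-1` A i)) =
  (\prod_(i in J) P (A i))%E.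
Proof.
move=> rK r'K mA.
have mC i : i \in J -> measurable ((fun w : N.-tuple T => tnth w (r i)) @^-1` A i).
  move=> iJ; rewrite -[X in measurable X]setTI.
  by apply: measurable_tnth => //; exact: mA.
(* the event as a product over all coordinates, trivial outside of J *)
pose h (j : 'I_N) (x : T) : R := if r' j \in J then \1_(A (r' j)) x else 1.
have mh j : measurable_fun setT (h j).
  rewrite /h; case: (boolP (r' j \in J)) => jJ; last exact: measurable_cst.
  by apply: measurable_indic; exact: mA.
have h0 j x : 0 <= h j x by rewrite /h; case: ifP.
have hE : (\prod_(j < N) \int[P]_x (h j x)%:E = \prod_(i in J) P (A i))%E.
  rewrite (reindex r)/=; last by exists r' => ? _.
  rewrite [RHS]big_mkcond/=; apply: eq_bigr => i _; rewrite /h rK.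
  case: ifPn => iJ; first by rewrite integral_indic ?setIT//; exact: mA.
  rewrite integral_cst// mul1e; exact: probability_setT.
rewrite -hE -ge0_integral_iid_prod//.
set D := \bigcap_(i in _) _.
have mD : measurable D.
  by apply: fin_bigcap_measurable => // i; exact: mC.
have := integral_indic (iid P N) measurableT mD; rewrite setIT => <-; apply: eq_integral => w _.
rewrite (reindex r)/=; last by exists r' => ? _.
congr EFin; rewrite indicE/=; case: (boolP (w \in D)) => [/set_mem wD|wD].
  rewrite big1// => i _; rewrite /h rK; case: ifPn => // iJ.
  by rewrite indicE mem_set//; exact: wD.
have /existsNP[i /not_implyP[iJ wi]] : ~ forall i, i \in J -> A i (tnth w (r i)).
  by move=> H; move: wD; rewrite notin_setE; apply => i; exact: H.
by rewrite (bigD1 i)//= /h rK iJ indicE memNset// mul0r.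
Qed.

End iid_independence.

Section normal_moments.
Context {R : realType}.
Local Notation gauss := (normal_prob (0:R) 1).

Definition gauss_variance : R := fine (\int[gauss]_x (x ^+ 2)%:E)%E.

(** Comparison with the integral of a normal density of variance 2, through
    x^2 / 4 <= exp(x^2 / 4). *)
Lemma gauss_variance_lty : (\int[gauss]_x (x ^+ 2)%:E < +oo)%E.
Proof.
have m2 : measurable_fun setT (fun x : R => (x ^+ 2)%:E).
  by apply/measurable_EFinP; exact: measurable_funX.
have x20 (x : R) : (0 <= (x ^+ 2)%:E)%E by rewrite lee_fin sqr_ge0.
rewrite (ge0_integral_normal_prob 0 1 m2 x20).
pose q : R := Num.sqrt 2.
have q0 : 0 < q by rewrite sqrtr_gt0.
(* 4 bounds x^2 exp(-x^2 / 4), and the peaks normalize the two densities *)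
pose c : R := 4 * normal_peak 1 / normal_peak q.
have c0 : 0 <= c by rewrite divr_ge0 ?mulr_ge0 ?normal_peak_ge0.
apply: (@le_lt_trans _ _ (\int[lebesgue_measure]_x (c%:E * (normal_pdf 0 q x)%:E))%E).
  apply: ge0_le_integral => //.
  - by move=> x _; rewrite mule_ge0// lee_fin normal_pdf_ge0.
  - by apply: emeasurable_funM => //; apply/measurable_EFinP; exact: measurable_normal_pdf.
  - by apply: emeasurable_funM => //; apply/measurable_EFinP; exact: measurable_normal_pdf.
  - move=> x _; rewrite -!EFinM lee_fin !normal_pdfE ?gt_eqF//.
    have -> : c * (normal_peak q * normal_fun 0 q x) =
       normal_peak 1 * (4 * normal_fun 0 q x).
      by rewrite /c; field; rewrite gt_eqF// normal_peak_gt0// gt_eqF.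
    rewrite mulrCA ler_wpM2l ?normal_peak_ge0//.
    have -> : normal_fun 0 1 x = expR (- (x ^+ 2 / 4)) * normal_fun 0 q x.
      rewrite /normal_fun -expRD; congr expR.
      by rewrite sqr_sqrtr//; field.
    rewrite mulrA ler_wpM2r ?normal_fun_ge0// expRN ler_pdivrMr ?expR_gt0//.
    by have := expR_ge1Dx (x ^+ 2 / 4); lra.
rewrite ge0_integralZl//.
- by rewrite integral_normal_pdf mule1 ltry.
- by apply/measurable_EFinP; exact: measurable_normal_pdf.
- by move=> x _; rewrite lee_fin normal_pdf_ge0.
Qed.

Lemma gauss_varianceE : (\int[gauss]_x (x ^+ 2)%:E = gauss_variance%:E)%E.
Proof.
rewrite fineK// ge0_fin_numE ?gauss_variance_lty//.
by apply: integral_ge0 => x _; rewrite lee_fin sqr_ge0.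
Qed.

Lemma gauss_variance_gt0 : 0 < gauss_variance.
Proof.
rewrite lt_neqAle -lee_fin -gauss_varianceE integral_ge0 ?andbT; last first.
  by move=> x _; rewrite lee_fin sqr_ge0.
apply/eqP => v0.
have m2 : measurable_fun setT (fun x : measurableTypeR R => (x ^+ 2)%:E).
  by apply/measurable_EFinP; exact: measurable_funX.
have : (\int[gauss]_x `|(x ^+ 2)%:E| = 0)%E.
  under eq_integral do rewrite gee0_abs ?lee_fin ?sqr_ge0//.
  by rewrite gauss_varianceE -v0.
move/(ae_eq_integral_abs gauss measurableT m2) => [N [mN N0 sN]].
have : gauss (N `|` [set 0]) = 0%E.
  apply/eqP; rewrite eq_le measure_ge0 andbT.
  have N00 : gauss [set 0] = 0%E.
    have /null_content_dominatesP H := @normal_prob_dominates R 0 1.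
    by apply: H => //; exact: lebesgue_measure_set1.
  apply: (le_trans (measureU2 _ mN (measurable_set1 _))).
  by rewrite -[leRHS]adde0 leeD// le_eqVlt; apply/orP; left; apply/eqP.
(* a null second moment would force xi = 0 almost surely *)
have -> : N `|` [set 0] = setT.
  apply/seteqP; split => // x _; have [->|x0] := eqVneq x 0; first by right.
  left; apply: sN => /(_ I)/= -[] /eqP.
  by rewrite sqrf_eq0 (negbTE x0).
move=> g0; have /(congr1 fine)/=/eqP : 1%E = 0%E :> \bar R.
  by rewrite -g0; exact/esym/probability_setT.
by rewrite oner_eq0.
Qed.

(** By symmetry of the law, the positive and negative parts have the same
    integral, which is finite since |x| <= 1 + x^2. *)
Lemma gauss_odd (a : R) : (\int[gauss]_x (a * x)%:E = 0)%E.
Proof.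
have mg : measurable_fun setT (fun x : R => (a * x)%:E).
  by apply/measurable_EFinP; apply: measurable_funM.
rewrite integralE.
set f := fun x : R => (a * x)%:E.
have mfp : measurable_fun setT (f ^\+)%E by exact: measurable_funepos.
have f0 x : (0 <= (f ^\+) x)%E by exact: funepos_ge0.
have -> : (\int[gauss]_x (f ^\- x) = \int[gauss]_x (f ^\+ x))%E.
  transitivity (\int[gauss]_x (f ^\+ (-1 * x + 0)%R))%E.
    apply: eq_integral => x _; rewrite funeposE funenegE /f -EFinN.
    by congr (maxe (_ %:E) _); ring.
  have N10 : (-1 : R) != 0 by rewrite oppr_eq0 oner_eq0.
  rewrite (ge0_integral_normal_affine 0 0 N10 (oner_neq0 R) mfp f0).
  by rewrite mulr0 add0r normrN1 mulr1.
rewrite subee// ge0_fin_numE ?integral_ge0//.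
apply: (@le_lt_trans _ _ (\int[gauss]_x ((`|a|)%:E * (1 + (x ^+ 2)%:E)))%E).
  apply: ge0_le_integral => //.
  - apply: emeasurable_funM => //; apply: emeasurable_funD => //.
    by apply/measurable_EFinP; exact: measurable_funX.
  - move=> x _; rewrite funeposE /f -EFinD -EFinM -EFin_max lee_fin ge_max.
    rewrite mulr_ge0 ?addr_ge0 ?sqr_ge0// andbT.
    apply: le_trans (ler_norm _) _; rewrite normrM ler_wpM2l//.
    by rewrite -[x ^+ 2]real_normK ?num_real//; nra.
rewrite ge0_integralZl//; last 2 first.
- apply: emeasurable_funD => //.
  by apply/measurable_EFinP; exact: measurable_funX.
- by move=> x _; rewrite -EFinD lee_fin addr_ge0// sqr_ge0.
rewrite ge0_integralD//; last 2 first.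
- by move=> x _; rewrite lee_fin sqr_ge0.
- by apply/measurable_EFinP; exact: measurable_funX.
have E1 : (\int[gauss]_x 1 = 1)%E.
  by rewrite integral_cst// mul1e; exact: probability_setT.
by rewrite gauss_varianceE E1 -EFinD -EFinM ltry.
Qed.

End normal_moments.

(** * Rank-one Gaussian processes and their observation model *)

Section rank_one_process.
Context {R : realType}.
Local Notation gauss := (normal_prob (0:R) 1 : probability (measurableTypeR R) R).
Variable f : R -> R.

Let mf t : measurable_fun [set: measurableTypeR R] (fun x => f t * x : R).
Proof.
rewrite -[measurable_fun _ _]/(measurable_fun [set: R] (fun x : R => f t * x)).
exact: measurable_funM.
Qed.

Definition rank_one : process gauss := fun t =>
  HB.pack_for {mfun measurableTypeR R >-> R} (fun x : measurableTypeR R => f t * x)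
    (isMeasurableFun.Build _ _ _ _ _ (mf t)).

Lemma rank_oneE t x : rank_one t x = f t * x. Proof. by []. Qed.

Lemma measurable_path (C : set (R -> R)) : cylinder R C ->
  measurable (path_of rank_one @^-1` C).
Proof.
move=> CC; rewrite -[X in measurable X]setTI.
suff : image_set_system [set: measurableTypeR R] (path_of rank_one) measurable C by [].
move: C CC; apply: smallest_sub.
  by apply: sigma_algebra_image; exact: sigma_algebra_measurable.
move=> B [t _ [S mS <-]]; rewrite /image_set_system/= !setTI.
by have := mf t measurableT mS; rewrite setTI.
Qed.

Lemma gaussian_process_rank_one : gaussian_process rank_one.
Proof.
move=> m t c _; exists 0, `|\sum_(k < m) c k * f (t k)|; split => // B mB.
set a := \sum_(k < m) _.
have -> : (fun w => \sum_(k < m) c k * rank_one (t k) w) = (fun x => a * x).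
  apply/funext => x; rewrite /a mulr_suml; apply: eq_bigr => k _.
  by rewrite rank_oneE mulrA.
rewrite /gaussian_law normr_eq0; case: eqVneq => [->|a0].
  have [B0|B0] := pselect (B 0).
    rewrite (_ : _ @^-1` B = setT); last first.
      by apply/seteqP; split => // x _ /=; rewrite mul0r.
    by rewrite probability_setT diracE mem_set.
  rewrite (_ : _ @^-1` B = set0); last first.
    by apply/seteqP; split => // x /=; rewrite mul0r.
  by rewrite measure0 diracE memNset.
have mB1 : measurable_fun setT (fun x : R => (\1_B x : R)%:E).
  by apply/measurable_EFinP; exact: measurable_indic.
have B10 (x : R) : (0 <= (\1_B x : R)%:E)%E by rewrite lee_fin.
have := ge0_integral_normal_affine 0 0 a0 (oner_neq0 R) mB1 B10.
rewrite mulr0 add0r mulr1.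
have E : (\int[normal_prob 0 `|a|]_x (\1_B x)%:E = normal_prob 0 `|a| B)%E.
  have := integral_indic (normal_prob 0 `|a|) (@measurableT _ (measurableTypeR R)) mB.
  by rewrite setIT.
rewrite E => <-.
have maB : measurable ((fun x : measurableTypeR R => a * x) @^-1` B).
  rewrite -[X in measurable X]setTI.
  rewrite -[X in _ X]/([set: measurableTypeR R] `&` (fun x : R => a * x) @^-1` B).
  by have : measurable_fun [set: R] (fun x : R => a * x); [exact: measurable_funM|apply].
transitivity (\int[gauss]_x (\1_((fun x : measurableTypeR R => a * x) @^-1` B) x)%:E)%E.
  have := integral_indic gauss measurableT maB.
  by rewrite setIT => ->.
by apply: eq_integral => x _; rewrite addr0.
Qed.

Lemma centered_rank_one : centered rank_one.
Proof. by move=> t _; rewrite expectation_def; exact: gauss_odd. Qed.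

Lemma cov_kernel_rank_one v :
  cov_kernel rank_one v = gauss_variance * (f v.1 * f v.2).
Proof.
rewrite /cov_kernel unlock.
transitivity (fine (\int[gauss]_x ((f v.1 * f v.2)%:E * (x ^+ 2)%:E))%E).
  by congr fine; apply: eq_integral => x _; rewrite -EFinM !rank_oneE; congr EFin; ring.
rewrite integralZl//.
  by rewrite gauss_varianceE -EFinM/= mulrC.
apply/integrableP; split; first by apply/measurable_EFinP; exact: measurable_funX.
under eq_integral do rewrite gee0_abs ?lee_fin ?sqr_ge0//.
exact: gauss_variance_lty.
Qed.

Lemma gaussian_class_rank_one (g L : R) :
  holder_class g L (fun v => gauss_variance * (f v.1 * f v.2)) ->
  gaussian_class g L rank_one.
Proof.
move=> fL; split.
- exact: gaussian_process_rank_one.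
- exact: centered_rank_one.
- by rewrite (_ : cov_kernel _ = fun v => gauss_variance * (f v.1 * f v.2))//;
    apply/funext => v; exact: cov_kernel_rank_one.
Qed.

End rank_one_process.

Section iid_marginals.
Context d (T : measurableType d) (R : realType) (P : probability T R).

Lemma iid_marginal N (k : 'I_N) (A : set T) : measurable A ->
  iid P N ((fun w => tnth w k) @^-1` A) = P A.
Proof.
move=> mA.
have := @iid_coordinates _ T R P N 'I_N id id [set k]%SET (fun=> A).
rewrite big_set1 => <-//; congr (iid P N _).
apply/seteqP; split => [w /= Aw i /=|w /(_ k)/=]; first by rewrite inE => /eqP ->.
by rewrite inE eqxx; apply.
Qed.

End iid_marginals.

Section rank_one_model.
Context {R : realType}.
Local Notation gauss := (normal_prob (0:R) 1 : probability (measurableTypeR R) R).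
Variables (s : R) (n p : nat).
Local Notation N := #|{: 'I_n * 'I_p}|.
Local Notation noise := (normal_prob 0 s : probability (measurableTypeR R) R).

(** The variables xi_i are the first component, the errors the second one. *)
Definition sample_space : Type :=
  (n.-tuple (measurableTypeR R) * N.-tuple (measurableTypeR R))%type.
HB.instance Definition _ := Measurable.on sample_space.

Definition sample_prob : probability sample_space R :=
  (iid gauss n \x iid noise N)%E.

Let m1 (c : R) i : measurable_fun [set: sample_space] (fun w => c * tnth w.1 i : R).
Proof.
have mc : measurable_fun [set: measurableTypeR R] (fun x => c * x : R).
  rewrite -[measurable_fun _ _]/(measurable_fun [set: R] (fun x : R => c * x)).
  exact: measurable_funM.
apply: (measurableT_comp mc).
exact: (measurableT_comp (measurable_tnth i) measurable_fst).
Qed.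

Let m2 (k : 'I_N) : measurable_fun [set: sample_space] (fun w => tnth w.2 k : R).
Proof. exact: (measurableT_comp (measurable_tnth k) measurable_snd). Qed.

Definition copies (f : R -> R) (i : 'I_n) : process sample_prob := fun t =>
  HB.pack_for {mfun sample_space >-> R} (fun w : sample_space => f t * tnth w.1 i)
    (isMeasurableFun.Build _ _ _ _ _ (m1 (f t) i)).

Definition errors (i : 'I_n) (j : 'I_p) : {RV sample_prob >-> R} :=
  HB.pack_for {mfun sample_space >-> R} (fun w : sample_space => tnth w.2 (enum_rank (i, j)) : R)
    (isMeasurableFun.Build _ _ _ _ _ (m2 (enum_rank (i, j)))).

Lemma sample_prob_rect A B : measurable A -> measurable B ->
  sample_prob (fst @^-1` A `&` snd @^-1` B) = (iid gauss n A * iid noise N B)%E.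
Proof. by move=> mA mB; rewrite -product_measure1E. Qed.

Lemma sample_prob_fst A : measurable A -> sample_prob (fst @^-1` A) = iid gauss n A.
Proof.
move=> mA; rewrite -[RHS]mule1 -(probability_setT (iid noise N)).
by rewrite -sample_prob_rect// preimage_setT setIT.
Qed.

Lemma sample_prob_snd B : measurable B -> sample_prob (snd @^-1` B) = iid noise N B.
Proof.
move=> mB; rewrite -[RHS]mul1e -(probability_setT (iid gauss n)).
by rewrite -sample_prob_rect// preimage_setT setTI.
Qed.

Lemma sigma_process_copies (f : R -> R) i A : sigma_process (copies f i) A ->
  exists2 B, measurable B & A = fst @^-1` ((fun w => tnth w i) @^-1` B).
Proof.
move=> [C CC <-]; exists (path_of (rank_one f) @^-1` C); first exact: measurable_path.
by rewrite setTI.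
Qed.

Lemma sigma_join_sub (I : Type) d' (T' : measurableType d')
    (F : I -> set (set sample_space)) (phi : sample_space -> T') A :
  (forall i B, F i B -> exists2 S, measurable S & B = phi @^-1` S) ->
  sigma_join F A -> exists2 S, measurable S & A = phi @^-1` S.
Proof.
move=> FS; suff : sigma_join F `<=` preimage_set_system setT phi measurable.
  by move=> H /H[S mS <-]; exists S => //; rewrite setTI.
apply: smallest_sub.
  by apply: sigma_algebra_preimage; exact: sigma_algebra_measurable.
by move=> B [i _ /FS[S mS ->]]; exists S => //; rewrite setTI.
Qed.

Lemma noise_model_rank_one (f : R -> R) :
  noise_model s (rank_one f) (copies f) errors.
Proof.
have mt1 i (B : set (measurableTypeR R)) : measurable B ->
    measurable ((fun w : n.-tuple (measurableTypeR R) => tnth w i) @^-1` B).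
  by move=> mB; rewrite -[X in measurable X]setTI; exact: measurable_tnth.
have mt2 k (B : set (measurableTypeR R)) : measurable B ->
    measurable ((fun w : N.-tuple (measurableTypeR R) => tnth w k) @^-1` B).
  by move=> mB; rewrite -[X in measurable X]setTI; exact: measurable_tnth.
split.
- move=> i C CC; have mC := measurable_path f CC.
  rewrite -[LHS]/(sample_prob (fst @^-1` ((fun w => tnth w i) @^-1`
    (path_of (rank_one f) @^-1` C)))).
  by rewrite sample_prob_fst ?iid_marginal//; exact: mt1.
- move=> J A FA.
  have /choice[B BP] : forall i, exists B : set (measurableTypeR R), i \in J ->
      measurable B /\ A i = fst @^-1` ((fun w => tnth w i) @^-1` B).
    move=> i; have [iJ|] := boolP (i \in J); last by exists set0.
    by have [B mB AB] := sigma_process_copies (FA i iJ); exists B.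
  have -> : \bigcap_(i in [set` J]) A i =
      fst @^-1` (\bigcap_(i in [set` J]) ((fun w => tnth w i) @^-1` B i)).
    apply/seteqP; split=> w Aw i iJ; move: (Aw i iJ) => /=; by rewrite (BP i iJ).2.
  rewrite sample_prob_fst; last first.
    by apply: fin_bigcap_measurable => // i /= iJ; apply: mt1; exact: (BP i iJ).1.
  rewrite (@iid_coordinates _ _ _ gauss n 'I_n id id)//; last first.
    by move=> i iJ; exact: (BP i iJ).1.
  apply: eq_bigr => i iJ; have [mB ->] := BP i iJ.
  by rewrite sample_prob_fst ?iid_marginal//; exact: mt1.
- move=> i j B mB.
  rewrite -[LHS]/(sample_prob (snd @^-1` ((fun w => tnth w (enum_rank (i, j))) @^-1` B))).
  by rewrite sample_prob_snd ?iid_marginal//; exact: mt2.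
- move=> J A FA.
  have /choice[B BP] : forall ij, exists B : set (measurableTypeR R), ij \in J ->
      measurable B /\ A ij = snd @^-1` ((fun w => tnth w (enum_rank ij)) @^-1` B).
    move=> ij; have [ijJ|] := boolP (ij \in J); last by exists set0.
    have [B mB AB] := FA ij ijJ; exists B => _; split => //.
    by rewrite -AB setTI; case: (ij).
  have -> : \bigcap_(i in [set` J]) A i =
      snd @^-1` (\bigcap_(i in [set` J]) ((fun w => tnth w (enum_rank i)) @^-1` B i)).
    apply/seteqP; split=> w Aw i iJ; move: (Aw i iJ) => /=; by rewrite (BP i iJ).2.
  rewrite sample_prob_snd; last first.
    by apply: fin_bigcap_measurable => // i /= iJ; apply: mt2; exact: (BP i iJ).1.
  rewrite (@iid_coordinates _ _ _ noise N _ enum_rank enum_val)//; last 3 first.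
  + exact: enum_rankK.
  + exact: enum_valK.
  + by move=> i iJ; exact: (BP i iJ).1.
  apply: eq_bigr => i iJ; have [mB ->] := BP i iJ.
  by rewrite sample_prob_snd ?iid_marginal//; exact: mt2.
- move=> A B FA FB.
  have [S mS ->] : exists2 S, measurable S & A = fst @^-1` S.
    apply: sigma_join_sub FA => i C /sigma_process_copies[S mS ->].
    by exists ((fun w => tnth w i) @^-1` S) => //; exact: mt1.
  have [S' mS' ->] : exists2 S, measurable S & B = snd @^-1` S.
    apply: sigma_join_sub FB => ij C [S' mS' <-].
    exists ((fun w => tnth w (enum_rank ij)) @^-1` S'); first exact: mt2.
    by rewrite setTI; case: (ij).
  by rewrite sample_prob_rect// sample_prob_fst// sample_prob_snd.
Qed.

End rank_one_model.

(** * From estimation to testing *)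

Section lower_integral.
Context d (T : measurableType d) (R : realType) (mu : {measure set T -> \bar R}).

Import HBNNSimple.

(** The integral of a nonnegative function is a supremum over the simple
    functions below it, hence monotone without any measurability. *)
Lemma le_lower_integral (f1 f2 : T -> \bar R) :
  (forall x, 0 <= f1 x)%E -> (forall x, f1 x <= f2 x)%E ->
  (\int[mu]_x f1 x <= \int[mu]_x f2 x)%E.
Proof.
move=> f10 f12.
rewrite !ge0_integralTE//; last by move=> x; exact: le_trans (f12 x).
apply: ge_ereal_sup => _ [h /= hf1 <-].
apply: le_ereal_sup_tmp; exists (sintegral mu h) => //.
by exists h => // x; apply: le_trans (f12 x).
Qed.

Lemma lower_integral_ge (f : T -> \bar R) (c : R) (E : set T) : 0 <= c ->
  measurable E -> (forall x, 0 <= f x)%E -> (forall x, E x -> c%:E <= f x)%E ->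
  (c%:E * mu E <= \int[mu]_x f x)%E.
Proof.
move=> c0 mE f0 fE.
have <- : (\int[mu]_x (c%:E * (\1_E x)%:E) = c%:E * mu E)%E.
  rewrite ge0_integralZl//.
  - by have := integral_indic mu measurableT mE; rewrite setIT => ->.
  - by apply/measurable_EFinP; exact: measurable_indic.
apply: le_lower_integral => x; first by rewrite mule_ge0 ?lee_fin.
rewrite indicE; case: (boolP (x \in E)) => [/set_mem/fE|_].
  by rewrite mule1.
by rewrite mule0.
Qed.

End lower_integral.

Section testing_reduction.
Context {R : realType}.
Variables (g L s a : R) (mu : R -> R) (n p : nat) (x : 'I_p -> R).
Local Notation P := (sample_prob s n p).

Definition data (f : R -> R) : sample_space n p -> n.-tuple (p.-tuple R) :=
  observations mu x (@copies R s n p f) (@errors R s n p).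

Lemma measurable_data f : measurable_fun setT (data f).
Proof.
apply/measurable_fun_tnthP => i; apply/measurable_fun_tnthP => j.
rewrite [X in measurable_fun _ X](_ : _ =
    fun w => mu (x j) + @copies R s n p f i (x j) w + @errors R s n p i j w); last first.
  by apply/funext => w /=; rewrite !tnth_mktuple.
by apply: measurable_funD => //; apply: measurable_funD.
Qed.

Lemma rank_one_risk_le (G : n.-tuple (p.-tuple R) -> R * R -> R) (f : R -> R) :
  0 < a -> holder_class g L (fun v => gauss_variance * (f v.1 * f v.2)) ->
  ((a^-1)%:E * risk mu x G (rank_one f) (@copies R s n p f) (@errors R s n p) <=
   ereal_sup (scaled_risks g L s a mu x G))%E.
Proof.
move=> a0 fL; apply: ereal_sup_ubound.
do 9 eexists; split; first exact: (gaussian_class_rank_one fL).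
  exact: noise_model_rank_one.
by [].
Qed.

Lemma risk_ge (G : n.-tuple (p.-tuple R) -> R * R -> R) (f : R -> R) (c : R)
    (A : set (n.-tuple (p.-tuple R))) : 0 <= c -> measurable A ->
  (forall y, A y -> exists2 t, t \in `[(0:R), 1] &
     c <= `|G y (t, t) - gauss_variance * (f t * f t)|) ->
  (c%:E * P (data f @^-1` A) <=
   risk mu x G (rank_one f) (@copies R s n p f) (@errors R s n p))%E.
Proof.
move=> c0 mA AG.
have sup_ge y t : t \in `[(0:R), 1] ->
  (`|G y (t, t) - gauss_variance * (f t * f t)|%:E <=
   sup_norm (fun v => G y v - cov_kernel (rank_one f) v)%R)%E.
  move=> t01; apply: ereal_sup_ubound; exists (t, t) => //.
  by rewrite cov_kernel_rank_one.
apply: lower_integral_ge => //.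
- by rewrite -[X in measurable X]setTI; apply: measurable_data.
- move=> w; apply: le_trans (sup_ge _ 0 _); first by rewrite lee_fin.
  by rewrite in_itv/= lexx ler01.
- move=> w /AG[t t01 ct]; apply: le_trans (sup_ge _ t t01).
  by rewrite lee_fin.
Qed.

(** Let A be the set of data for which, at some t k, the estimator is at
    distance at least gap / 2 from the null kernel. On A the loss under the null
    hypothesis is at least gap / 2; off A the loss under each alternative is,
    by the triangle inequality. Adding the risk under the null hypothesis and
    the average risk under the alternatives, twice the supremum of the scaled
    risks is at least a^-1 * (gap / 2) * kappa. Evaluating the loss at finitely
    many points also avoids any question on the measurability of the supremum
    norm. *)
Lemma testing_reduction (J : finType) (f0 : R -> R) (f : J -> R -> R)
    (t : J -> R) (gap kappa : R) :
  0 < a -> (0 < #|J|)%N -> 0 <= gap ->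
  holder_class g L (fun v => gauss_variance * (f0 v.1 * f0 v.2)) ->
  (forall k, holder_class g L (fun v => gauss_variance * (f k v.1 * f k v.2))) ->
  (forall k, t k \in `[(0:R), 1]) ->
  (forall k, gap <= gauss_variance * (f k (t k) ^+ 2 - f0 (t k) ^+ 2)) ->
  (forall A, measurable A ->
     (kappa%:E <= P (data f0 @^-1` A) +
      (#|J|%:R^-1)%:E * \sum_k P (data (f k) @^-1` ~` A))%E) ->
  ((a^-1 * gap * kappa / 4)%:E <= minimax_risk g L s a n mu x)%E.
Proof.
move=> a0 J0 gap0 f0L fL t01 gapE test.
have J0' : 0 < #|J|%:R :> R by rewrite ltr0n.
apply: le_ereal_inf_tmp => _ [G estG <-].
set S := ereal_sup _.
pose A := \big[setU/set0]_(k : J)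
  [set y | gap / 2 <= `|G y (t k, t k) - gauss_variance * (f0 (t k) * f0 (t k))|].
have mG k : measurable_fun setT
    (fun y => `|G y (t k, t k) - gauss_variance * (f0 (t k) * f0 (t k))|).
  apply: measurableT_comp => //; apply: measurable_funB => //.
  by apply: estG; split; exact: t01.
have mA : measurable A.
  apply: bigsetU_measurable => k _.
  rewrite -[X in measurable X]setTI.
  by have := mG k measurableT _ (measurable_itv `[gap / 2, +oo[); rewrite set_itvE.
have gap2 : 0 <= gap / 2 by rewrite divr_ge0.
have far (z u : R) : gap <= u -> `|z| < gap / 2 -> gap / 2 <= `|z - u|.
  move=> ug; rewrite ltr_norml => /andP[_ zl].
  by rewrite distrC; apply: le_trans (ler_norm _); lra.
have P_fin B : measurable B -> P B = (fine (P B))%:E.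
  by move=> mB; rewrite fineK// fin_num_measure.
have mD h B : measurable B -> measurable (data h @^-1` B).
  by move=> mB; rewrite -[X in measurable X]setTI; apply: measurable_data.
have S0 : ((a^-1 * (gap / 2) * fine (P (data f0 @^-1` A)))%:E <= S)%E.
  apply: le_trans (rank_one_risk_le G a0 f0L); rewrite -mulrA EFinM.
  apply: lee_wpmul2l; first by rewrite lee_fin invr_ge0 ltW.
  rewrite EFinM -(P_fin _ (mD _ _ mA)); apply: risk_ge => // y.
  by rewrite /A -bigcup_seq/= => -[k _ /= ky]; exists (t k).
have Sk k : ((a^-1 * (gap / 2) * fine (P (data (f k) @^-1` ~` A)))%:E <= S)%E.
  apply: le_trans (rank_one_risk_le G a0 (fL k)); rewrite -mulrA EFinM.
  apply: lee_wpmul2l; first by rewrite lee_fin invr_ge0 ltW.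
  rewrite EFinM -(P_fin _ (mD _ _ (measurableC mA))).
  apply: risk_ge => //; first exact: measurableC.
  move=> y Ay; exists (t k) => //.
  have : ~ (gap / 2 <= `|G y (t k, t k) - gauss_variance * (f0 (t k) * f0 (t k))|).
    move=> H; apply: Ay; rewrite /A -bigcup_seq/=.
    by exists k => //=; rewrite mem_index_enum.
  move/negP; rewrite -ltNge => lt2.
  have -> : G y (t k, t k) - gauss_variance * (f k (t k) * f k (t k)) =
    (G y (t k, t k) - gauss_variance * (f0 (t k) * f0 (t k))) -
    gauss_variance * (f k (t k) ^+ 2 - f0 (t k) ^+ 2) by ring.
  exact: far (gapE k) lt2.
have := test A mA; case: S S0 Sk => [r| |] S0 Sk; last 2 first.
- by rewrite leey.
- by move: S0; rewrite leeNy_eq.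
rewrite (P_fin _ (mD _ _ mA)).
under eq_bigr do rewrite (P_fin _ (mD _ _ (measurableC mA))).
rewrite sumEFin -EFinM -EFinD !lee_fin.
set p0 := fine _; set ps := \sum_k _ => H.
rewrite lee_fin in S0.
have sum_le : a^-1 * (gap / 2) * ps <= #|J|%:R * r.
  rewrite mulr_sumr (@le_trans _ _ (\sum_(k : J) r))//.
    by apply: ler_sum => k _; have := Sk k; rewrite lee_fin.
  by rewrite sumr_const mulr_natl.
have avg_le : a^-1 * (gap / 2) * (#|J|%:R^-1 * ps) <= r.
  by rewrite mulrCA ler_pdivrMl.
have q0 : 0 <= a^-1 * (gap / 2) by rewrite mulr_ge0// invr_ge0 ltW.
have := ler_wpM2l q0 H; rewrite mulrDr => H2.
have -> : a^-1 * gap * kappa / 4 = (a^-1 * (gap / 2) * kappa) / 2 by field; rewrite gt_eqF.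
rewrite ler_pdivrMr//; apply: le_trans H2 _.
by rewrite mulr_natr mulr2n lerD.
Qed.

End testing_reduction.

(** * Testing between rank-one hypotheses from the data *)

Section average.
Context d (T : measurableType d) (R : realType) (mu : {measure set T -> \bar R}).

(** Integrates a testing bound that holds conditionally on x in S. *)
Lemma integral_average_ge (J : finType) (F0 : T -> \bar R) (F : J -> T -> \bar R)
    (c r : R) (S : set T) : 0 <= c -> 0 <= r -> measurable S ->
  measurable_fun setT F0 -> (forall x, 0 <= F0 x)%E ->
  (forall k, measurable_fun setT (F k)) -> (forall k x, 0 <= F k x)%E ->
  (forall x, S x -> c%:E <= F0 x + r%:E * \sum_k F k x)%E ->
  (c%:E * mu S <= \int[mu]_x F0 x + r%:E * \sum_k \int[mu]_x F k x)%E.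
Proof.
move=> c0 r0 mS mF0 F00 mF Fge0 H.
have mSF : measurable_fun setT (fun x => \sum_k F k x)%E.
  exact: emeasurable_sum.
have SF0 x : (0 <= \sum_k F k x)%E by apply: sume_ge0.
have r0' : (0 <= r%:E)%E by rewrite lee_fin.
rewrite -ge0_integral_sum// -ge0_integralZl// -ge0_integralD//; last 2 first.
- by move=> x _; rewrite mule_ge0.
- by apply: emeasurable_funM.
apply: lower_integral_ge => // x.
by rewrite adde_ge0// mule_ge0.
Qed.

End average.

Section data_tests.
Context {R : realType}.
Variables (s : R) (mu : R -> R) (n p : nat) (x : 'I_p -> R).
Local Notation P := (sample_prob s n p).
Local Notation gauss := (normal_prob (0:R) 1 : probability (measurableTypeR R) R).
Local Notation N := #|{: 'I_n * 'I_p}|.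
Local Notation noise := (normal_prob 0 s : probability (measurableTypeR R) R).

Lemma dataE (f : R -> R) (w : @sample_space R n p) i j : tnth (tnth (data s mu x f w) i) j =
  mu (x j) + f (x j) * tnth w.1 i + tnth w.2 (enum_rank (i, j)).
Proof. by rewrite !tnth_mktuple. Qed.

Lemma sample_prob_xsection A : P A = (\int[iid gauss n]_w iid noise N (pair w @^-1` A))%E.
Proof. by apply: eq_integral => w _ /=; rewrite xsectionE. Qed.

Lemma sample_prob_ysection A : measurable A ->
  P A = (\int[iid noise N]_w iid gauss n (pair^~ w @^-1` A))%E.
Proof.
move=> mA.
(* integrating the two components in the other order *)
transitivity ((iid gauss n \x^ iid noise N)%E A).
  apply: product_measure_unique => // B C mB mC.
  exact: product_measure2E.
by apply: eq_integral => w _ /=; rewrite ysectionE.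
Qed.

Let energy (w : n.-tuple (measurableTypeR R)) : R := \sum_(i < n) tnth w i ^+ 2.

Let measurable_energy : measurable_fun setT energy.
Proof.
apply: measurable_sum => i.
have mX : measurable_fun [set: measurableTypeR R] (fun x => x ^+ 2 : R).
  rewrite -[measurable_fun _ _]/(measurable_fun [set: R] (fun x : R => x ^+ 2)).
  exact: measurable_funX.
exact: (measurableT_comp mX (measurable_tnth i)).
Qed.

Let measurable_energy_le (c : R) : measurable [set w | energy w <= c].
Proof.
rewrite -[X in measurable X]setTI.
have := measurable_energy measurableT (measurable_itv `]-oo, c]).
by rewrite set_itvE.
Qed.

(** Markov's inequality for the complement. *)
Lemma energy_typical : (0 < n)%N ->
  ((2^-1)%:E <= iid gauss n [set w | (energy w <= 2 * n%:R * gauss_variance)%R])%E.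
Proof.
move=> n0; set E := [set w | _].
have n0' : 0 < n%:R :> R by rewrite ltr0n.
have v0 := @gauss_variance_gt0 R.
have nv0 : 0 < n%:R * gauss_variance :> R by rewrite mulr_gt0.
have me i : measurable_fun setT (fun w : n.-tuple (measurableTypeR R) => tnth w i ^+ 2 : R).
  have mX : measurable_fun [set: measurableTypeR R] (fun x => x ^+ 2 : R).
    rewrite -[measurable_fun _ _]/(measurable_fun [set: R] (fun x : R => x ^+ 2)).
    exact: measurable_funX.
  exact: (measurableT_comp mX (measurable_tnth i)).
have mE : measurable E by exact: measurable_energy_le.
have energy0 w : 0 <= energy w by apply: sumr_ge0 => i _; exact: sqr_ge0.
have int_energy : (\int[iid gauss n]_w (energy w)%:E = (n%:R * gauss_variance)%:E)%E.
  under eq_integral do rewrite -sumEFin.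
  rewrite ge0_integral_sum//; last 2 first.
  - by move=> i; exact/measurable_EFinP.
  - by move=> i w _; rewrite lee_fin sqr_ge0.
  rewrite (eq_bigr (fun=> gauss_variance%:E)) => [|i _].
    by rewrite sumEFin sumr_const card_ord mulr_natl.
  pose h (j : 'I_n) (y : measurableTypeR R) : R := if j == i then y ^+ 2 else 1.
  transitivity (\int[iid gauss n]_w (\prod_(j < n) h j (tnth w j))%:E)%E.
    apply: eq_integral => w _; congr EFin; rewrite (bigD1 i)//= /h eqxx.
    by rewrite big1 ?mulr1// => j /negbTE ->.
  rewrite ge0_integral_iid_prod.
  - rewrite (bigD1 i)//= /h eqxx gauss_varianceE big1 ?mule1// => j /negbTE ->.
    by rewrite integral_cst// mul1e; exact: probability_setT.
  - move=> j; rewrite /h; case: (j == i); last exact: measurable_cst.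
    rewrite -[measurable_fun _ _]/(measurable_fun [set: R] (fun x : R => x ^+ 2)).
    exact: measurable_funX.
  - by move=> j y; rewrite /h; case: ifP => // _; exact: sqr_ge0.
have : ((2 * n%:R * gauss_variance)%:E * iid gauss n (~` E) <=
    (n%:R * gauss_variance)%:E)%E.
  rewrite -int_energy; apply: lower_integral_ge.
  - by rewrite -mulrA mulr_ge0// ltW.
  - exact: measurableC.
  - by move=> w; rewrite lee_fin.
  - by move=> w /= /negP; rewrite -ltNge lee_fin => /ltW.
have fE : iid gauss n E \is a fin_num by exact: fin_num_measure.
rewrite probability_setC// -(fineK fE) -EFinB -EFinM !lee_fin.
set q := fine _ => H.
have : 2 * (1 - q) <= 1.
  rewrite -(ler_pM2l nv0) mulr1; apply: le_trans H.
  by rewrite le_eqVlt; apply/orP; left; apply/eqP; ring.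
lra.
Qed.

(** Conditionally on the first component, that is on the xi_i, passing from f0
    to f k translates the error of index (i, j) by (f k - f0)(x j) * xi_i. The
    squared length of this translation is at most D times the sum of the xi_i^2,
    hence at most 2 n v D on an event of probability at least 1/2. Conditioning
    avoids exponential moments of the xi_i^2, which may be infinite. *)
Lemma data_shift_test (J : finType) (f0 : R -> R) (f : J -> R -> R) (D C : R)
    (A : set (n.-tuple (p.-tuple R))) :
  0 < s -> (0 < n)%N -> (0 < #|J|)%N ->
  (forall k l j, k != l -> (f k (x j) - f0 (x j)) * (f l (x j) - f0 (x j)) = 0) ->
  (forall k, \sum_j (f k (x j) - f0 (x j)) ^+ 2 <= D) ->
  2 <= C ->
  1 + expR (2 * n%:R * gauss_variance * D / s ^+ 2) / #|J|%:R <= C ->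
  measurable A ->
  (((2 * C)^-1)%:E <= P (data s mu x f0 @^-1` A) +
     (#|J|%:R^-1)%:E * \sum_k P (data s mu x (f k) @^-1` ~` A))%E.
Proof.
move=> s0 n0 J0 orth fD C2 CD mA.
have C0 : 0 < C by apply: lt_le_trans C2.
have mD h (B : set (n.-tuple (p.-tuple R))) : measurable B -> measurable (data s mu x h @^-1` B).
  by move=> mB; rewrite -[X in measurable X]setTI; apply: measurable_data.
set E := [set w | energy w <= 2 * n%:R * gauss_variance].
have mx (B : set (n.-tuple (measurableTypeR R) * N.-tuple (measurableTypeR R))%type) :
    measurable B -> measurable_fun setT
    (fun w => iid noise N (pair w @^-1` B)).
  move=> mB; have := measurable_fun_xsection (iid noise N) mB.
  by under [X in measurable_fun _ X -> _]eq_fun do rewrite /= xsectionE.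
apply: (@le_trans _ _ ((C^-1)%:E * iid gauss n E)%E).
  rewrite invfM mulrC EFinM lee_wpmul2l ?lee_fin ?invr_ge0 ?(ltW C0)//.
  exact: energy_typical.
rewrite sample_prob_xsection.
under [in leRHS]eq_bigr do rewrite sample_prob_xsection.
apply: integral_average_ge.
- by rewrite invr_ge0 ltW.
- by rewrite invr_ge0 ler0n.
- exact: measurable_energy_le.
- exact: (mx _ (mD f0 A mA)).
- by move=> w; exact: measure_ge0.
- by move=> k; exact: (mx _ (mD _ _ (measurableC mA))).
- by move=> k w; exact: measure_ge0.
move=> w1 /= Ew.
pose v k (q : 'I_N) : R :=
  (f k (x (enum_val q).2) - f0 (x (enum_val q).2)) * tnth w1 (enum_val q).1.
have -> : (\sum_k iid noise N (pair w1 @^-1` (data s mu x (f k) @^-1` ~` A)) =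
  \sum_k iid noise N ((fun w2 => [tuple (tnth w2 q + v k q)%R | q < N]) @^-1`
     ~` (pair w1 @^-1` (data s mu x f0 @^-1` A))))%E.
  apply: eq_bigr => k _; congr (iid noise N _); apply/funext => w2 /=.
  congr (~ A _); apply: eq_from_tnth => i; apply: eq_from_tnth => j.
  rewrite !dataE/= tnth_mktuple /v enum_rankK/=.
  by ring.
apply: (@shift_test _ _ _ _ _ (2 * n%:R * gauss_variance * D / s ^+ 2)) => //.
- by move=> k l q kl; rewrite /v mulrACA orth// mul0r.
- move=> k; rewrite divfK; last by rewrite gt_eqF// exprn_gt0.
  pose a (q : 'I_n * 'I_p) := ((f k (x q.2) - f0 (x q.2)) * tnth w1 q.1) ^+ 2.
  have -> : \sum_q v k q ^+ 2 = \sum_q a q.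
    by rewrite [RHS](reindex_onto enum_val enum_rank)/=; [|move=> i _; exact: enum_rankK];
      apply: eq_big => // q; rewrite enum_valK eqxx.
  rewrite -(pair_bigA _ (fun i j => a (i, j)))/=.
  apply: (@le_trans _ _ (\sum_i tnth w1 i ^+ 2 * D)).
    apply: ler_sum => i _; rewrite /a/=.
    under eq_bigr do rewrite exprMn mulrC.
    by rewrite -mulr_sumr ler_wpM2l// sqr_ge0.
  rewrite -mulr_suml ler_wpM2r// (le_trans _ (fD k))//.
  by apply: sumr_ge0 => j _; exact: sqr_ge0.
- by rewrite -[X in measurable X]setTI; apply: pair1_measurable => //; exact: mD.
Qed.

(** Conditionally on the errors, multiplying the constant b by a factor amounts
    to multiplying all the xi_i by it. *)
Lemma data_scale_test (b : R) (A : set (n.-tuple (p.-tuple R))) :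
  (0 < n)%N -> measurable A ->
  ((2^-1)%:E <= P (data s mu x (cst b) @^-1` A) +
     P (data s mu x (cst (b * (1 + scale_factor n))%R) @^-1` ~` A))%E.
Proof.
move=> n0 mA.
have mD h (B : set (n.-tuple (p.-tuple R))) : measurable B -> measurable (data s mu x h @^-1` B).
  by move=> mB; rewrite -[X in measurable X]setTI; apply: measurable_data.
have my (B : set (n.-tuple (measurableTypeR R) * N.-tuple (measurableTypeR R))%type) :
    measurable B -> measurable_fun setT
    (fun w => iid gauss n (pair^~ w @^-1` B)).
  move=> mB; have := measurable_fun_ysection (iid gauss n) mB.
  by under [X in measurable_fun _ X -> _]eq_fun do rewrite /= ysectionE.
rewrite !sample_prob_ysection; last 2 first.
- by apply: mD; exact: measurableC.
- exact: mD.
set b' := b * _.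
pose F0 w2 := iid gauss n (pair^~ w2 @^-1` (data s mu x (cst b) @^-1` A)).
pose F1 w2 := iid gauss n (pair^~ w2 @^-1` (data s mu x (cst b') @^-1` ~` A)).
have := @integral_average_ge _ _ _ (iid noise N) 'I_1 F0 (fun=> F1) 2^-1 1 setT.
rewrite big_ord1 mul1e => test.
rewrite -[leLHS]mule1 -(probability_setT (iid noise N)); apply: test => //.
- exact: (my _ (mD _ _ mA)).
- by move=> k; exact: (my _ (mD _ _ (measurableC mA))).
move=> w2 _; rewrite big_ord1 mul1e /F0 /F1.
have -> : pair^~ w2 @^-1` (data s mu x (cst b') @^-1` ~` A) =
  (fun w1 : n.-tuple (measurableTypeR R) =>
     [tuple ((1 + scale_factor n) * tnth w1 i)%R | i < n]) @^-1`
     ~` (pair^~ w2 @^-1` (data s mu x (cst b) @^-1` A)).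
  apply/funext => w1 /=.
  congr (~ A _); apply: eq_from_tnth => i; apply: eq_from_tnth => j.
  by rewrite !dataE/= tnth_mktuple mulrA.
apply: scale_test => //.
by rewrite -[X in measurable X]setTI; apply: pair2_measurable => //; exact: mD.
Qed.

End data_tests.

(** * Design points in a regular partition of the unit interval *)

Section bins.
Context {R : realType}.
Variables (p : nat) (x : 'I_p -> R) (M : nat).
Hypothesis M_gt0 : (0 < M)%N.
Local Notation h := (M%:R^-1 : R).

Definition bin_count (k : 'I_M) : nat :=
  #|[pred j | k%:R * h < x j < k.+1%:R * h]|.

Let h_gt0 : 0 < h. Proof. by rewrite invr_gt0 ltr0n. Qed.

Lemma bins_disjoint (k l : 'I_M) (t : R) :
  k%:R * h < t < k.+1%:R * h -> l%:R * h < t < l.+1%:R * h -> k = l.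
Proof.
have aux (i j : 'I_M) : i%:R * h < t < i.+1%:R * h -> j%:R * h < t < j.+1%:R * h ->
    (i <= j)%N.
  move=> /andP[it _] /andP[_ tj].
  by have := lt_trans it tj; rewrite ltr_pM2r// ltr_nat ltnS.
by move=> tk tl; apply/val_inj/eqP; rewrite eqn_leq !aux.
Qed.

Lemma sum_bin_count : (\sum_k bin_count k <= p)%N.
Proof.
rewrite -[leqRHS]card_ord -sum1_card.
under eq_bigr do rewrite /bin_count -sum1_card big_mkcond/=.
rewrite exchange_big/=; apply: leq_sum => j _.
have [/existsP[k kj]|none] := boolP [exists k : 'I_M, k%:R * h < x j < k.+1%:R * h].
  rewrite (bigD1 k)//= inE kj big1 ?addn0// => l lk.
  rewrite inE; case: ifP => // lj.
  by move: lk; rewrite (bins_disjoint lj kj) eqxx.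
rewrite big1// => k _; rewrite inE; case: ifP => // kj.
by move/existsPn: none => /(_ k); rewrite kj.
Qed.

Lemma empty_bin : (p < M)%N -> exists k, bin_count k = 0%N.
Proof.
move=> pM; apply: contrapT => none.
have : (\sum_(k : 'I_M) 1 <= \sum_k bin_count k)%N.
  apply: leq_sum => k _; rewrite lt0n; apply/eqP => k0.
  by apply: none; exists k.
by rewrite sum1_card card_ord leqNgt (leq_ltn_trans sum_bin_count).
Qed.

(** Markov's inequality: there are M bins for p points, so fewer than half of
    the bins contain more than twice the average number p / M. *)
Lemma many_light_bins :
  (M <= 2 * #|[set k : 'I_M | bin_count k * M <= 2 * p]%SET|)%N.
Proof.
set S := [set k | _]%SET.
have SC : (#|S| + #|~: S| = M)%N by rewrite cardsC card_ord.
(* a heavy bin contains strictly more than 2 p / M points *)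
have heavy : (#|~: S| * (2 * p).+1 <= p * M)%N.
  apply: (@leq_trans (\sum_(k in ~: S) bin_count k * M)).
    rewrite -sum_nat_const; apply: leq_sum => k.
    by rewrite !inE -ltnNge.
  rewrite -big_distrl leq_mul2r; apply/orP; right.
  apply: leq_trans sum_bin_count.
  by rewrite [leqRHS](bigID (mem (~: S)%SET))/= leq_addr.
nia.
Qed.

End bins.

(** * Risk bounds for given bins and for a change of scale *)

Section lower_bounds.
Context {R : realType}.
Variables (g L s : R) (mu : R -> R) (b K : R).
Hypotheses (g_gt0 : 0 < g) (s_gt0 : 0 < s) (b_gt0 : 0 < b) (K_ge1 : 1 <= K).
Local Notation k0 := (strict_floor g).
Hypothesis bumpK : forall i, (i <= k0.+2)%N ->
  (forall t, `|bump k0.+2 i t| <= K) /\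
  (forall t u : R, `|bump k0.+2 i t - bump k0.+2 i u| <= K * `|t - u|).
Hypothesis bL : 3 * gauss_variance * (b * (1 + 2 * K)) ^+ 2 <= L.
Local Notation v := (@gauss_variance R).

Let v_gt0 : 0 < v. Proof. exact: gauss_variance_gt0. Qed.

Let K_ge0 : 0 <= K. Proof. exact: le_trans ler01 K_ge1. Qed.

Let b_le : b <= b * (1 + 2 * K).
Proof. by rewrite ler_peMr ?(ltW b_gt0)// lerDl mulr_ge0. Qed.

Lemma holder_class_cst (b' : R) : 0 <= b' <= b * (1 + 2 * K) ->
  holder_class g L (fun w => v * (cst b' w.1 * cst b' w.2)).
Proof.
move=> b'b; have F := holder_profile_cst g b'b.
exact: (holder_class_rank_one g_gt0 F (ltW v_gt0) bL).
Qed.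

(** Alternatives: one bump in each bin of S. The distance between the kernels at
    the midpoint of a bin is v b^2 ((1 + dl)^2 - 1) >= 2 v b^2 dl. *)
Lemma bump_risk_ge (n p M : nat) (x : 'I_p -> R) (S : {set 'I_M}) (m dl a C : R) :
  (0 < n)%N -> (0 < M)%N -> (0 < #|S|)%N ->
  (forall k, k \in S -> (bin_count x k)%:R <= m) ->
  0 <= dl <= (M%:R^-1) `^ g -> 0 < a -> 2 <= C ->
  1 + expR (2 * n%:R * v * ((b * dl * K) ^+ 2 * m) / s ^+ 2) / #|S|%:R <= C ->
  ((a^-1 * (v * b ^+ 2 * dl) / (4 * C))%:E <= minimax_risk g L s a n mu x)%E.
Proof.
move=> n0 M0 S0 Sm dlh a0 C2 CS.
have C0 : 0 < C by apply: lt_le_trans C2.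
have M0' : 0 < M%:R :> R by rewrite ltr0n.
set h := M%:R^-1 in dlh *.
have h0 : 0 < h by rewrite invr_gt0.
have h1 : 0 < h <= 1 by rewrite h0 invf_le1// ler1n.
have dl0 : 0 <= dl by case/andP: dlh.
pose J : finType := {k : 'I_M | k \in S}.
have cardJ : #|J| = #|S| by rewrite card_sig; apply: eq_card => k; rewrite inE.
pose f (k : 'I_M) := bump_profile g b dl h (k%:R * h) 0.
have fE k t : f k t - b = b * dl * bump k0.+2 0 (h^-1 * t - k%:R).
  rewrite /f /bump_profile/= expr0 invr1 mulr1 addrC addKr.
  by congr (_ * bump _ _ (_ + _)); rewrite mulNr mulfK// gt_eqF.
have f_out (k : 'I_M) t : ~~ (k%:R * h < t < k.+1%:R * h) -> f k t - b = 0.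
  move=> kt; rewrite fE bump_out ?mulr0//; apply: contra kt.
  rewrite subr_gt0 ltrBlDr [1 + _]addrC natr1 => /andP[t0 t1].
  by rewrite -ltr_pdivlMr// mulrC t0/= -ltr_pdivrMr// mulrC.
have f_bound k t : (f k t - b) ^+ 2 <= (b * dl * K) ^+ 2.
  rewrite fE -[leLHS]real_normK ?num_real// normrM.
  rewrite ger0_norm; last by rewrite mulr_ge0// ltW.
  rewrite lerXn2r ?nnegrE ?mulr_ge0 ?(ltW b_gt0)//.
  rewrite ler_wpM2l ?mulr_ge0// ?(ltW b_gt0)//.
  by apply: (bumpK (i := 0) _).1.
pose mid (k : J) : R := ((val k)%:R + 2^-1) * h.
have f_mid (k : J) : f (val k) (mid k) = b * (1 + dl).
  have E : h^-1 * mid k - (val k)%:R = 2^-1.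
    by rewrite /mid mulrCA mulVf ?mulr1 ?gt_eqF// addrAC subrr add0r.
  by have := fE (val k) (mid k); rewrite E bump_mid => /eqP; rewrite subr_eq => /eqP ->; ring.
have -> : a^-1 * (v * b ^+ 2 * dl) / (4 * C) =
    a^-1 * (2 * v * b ^+ 2 * dl) * (2 * C)^-1 / 4.
  by field; rewrite !gt_eqF.
apply: (@testing_reduction _ g L s a mu n p x J (cst b) (fun k => f (val k)) mid) => //.
- by rewrite cardJ.
- by rewrite !mulr_ge0// ?ltW// sqr_ge0.
- by apply: holder_class_cst; rewrite (ltW b_gt0) b_le.
- move=> k.
  have F := bump_profile_holder (g := g) g_gt0 ((val k)%:R * h) (ltW b_gt0) h1 dlh K_ge1 bumpK.
  exact: (holder_class_rank_one g_gt0 F (ltW v_gt0) bL).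
- move=> k; rewrite in_itv/= /mid mulr_ge0 ?addr_ge0 ?invr_ge0 ?ler0n ?(ltW h0)//=.
  rewrite ler_pdivrMr// mul1r.
  apply: (@le_trans _ _ (val k).+1%:R); first by rewrite -[leRHS]natr1 lerD2l; lra.
  by rewrite ler_nat ltn_ord.
- move=> k; rewrite f_mid/=.
  have -> : v * ((b * (1 + dl)) ^+ 2 - b ^+ 2) =
    2 * v * b ^+ 2 * dl + v * (b * dl) ^+ 2 by ring.
  by rewrite lerDl mulr_ge0 ?sqr_ge0// ltW.
move=> A mA.
apply: (@data_shift_test _ _ _ _ _ _ J _ _ ((b * dl * K) ^+ 2 * m)) => //.
- by rewrite cardJ.
- move=> k l j kl /=.
  have [jk|/f_out ->] := boolP ((val k)%:R * h < x j < (val k).+1%:R * h); last by rewrite mul0r.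
  have [jl|/f_out ->] := boolP ((val l)%:R * h < x j < (val l).+1%:R * h); last by rewrite mulr0.
  by move: kl; rewrite -val_eqE /= (bins_disjoint M0 jk jl) eqxx.
- move=> k /=.
  apply: (@le_trans _ _ (\sum_(j | (val k)%:R * h < x j < (val k).+1%:R * h) (b * dl * K) ^+ 2)).
    rewrite [leRHS]big_mkcond/=; apply: ler_sum => j _.
    by case: ifPn => [_|/f_out ->]; [exact: f_bound|rewrite expr0n].
  rewrite sumr_const -[leLHS]mulr_natr ler_wpM2l ?sqr_ge0//.
  exact: Sm (valP k).
- by rewrite cardJ.
Qed.

Lemma scale_risk_ge (n p : nat) (x : 'I_p -> R) (a : R) : (0 < n)%N -> 0 < a ->
  ((a^-1 * (v * b ^+ 2 * scale_factor n) / 4)%:E <= minimax_risk g L s a n mu x)%E.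
Proof.
move=> n0 a0; set dl := scale_factor n.
have n1 : 1 <= Num.sqrt n%:R :> R by rewrite -[leLHS]sqrtr1 ler_wsqrtr// ler1n.
have dl0 : 0 < dl by rewrite invr_gt0 mulr_gt0// (lt_le_trans ltr01).
have dl1 : dl <= 1.
  rewrite /dl /scale_factor invf_le1; last by rewrite mulr_gt0// (lt_le_trans ltr01).
  by rewrite (le_trans n1)// ler_peMl ?sqrtr_ge0// ler1n.
have -> : a^-1 * (v * b ^+ 2 * dl) / 4 = a^-1 * (2 * v * b ^+ 2 * dl) * 2^-1 / 4.
  by field; rewrite gt_eqF.
apply: (@testing_reduction _ g L s a mu n p x 'I_1 (cst b) (fun=> cst (b * (1 + dl)))
  (fun=> 0)) => //.
- by rewrite card_ord.
- by rewrite !mulr_ge0// ?ltW// sqr_ge0.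
- by apply: holder_class_cst; rewrite (ltW b_gt0) b_le.
- move=> _; apply: holder_class_cst; rewrite mulr_ge0 ?addr_ge0 ?(ltW dl0) ?(ltW b_gt0)//=.
  by rewrite ler_wpM2l ?(ltW b_gt0)// lerD2l (le_trans dl1)// (le_trans K_ge1)// ler_peMl// ler1n.
- by move=> _; rewrite in_itv/= lexx ler01.
- move=> _ /=.
  have -> : v * ((b * (1 + dl)) ^+ 2 - b ^+ 2) =
    2 * v * b ^+ 2 * dl + v * (b * dl) ^+ 2 by ring.
  by rewrite lerDl mulr_ge0 ?sqr_ge0// ltW.
move=> A mA; rewrite big_ord1 card_ord invr1 mul1e.
exact: data_scale_test.
Qed.

End lower_bounds.

(** * The three rates and the minimax lower bound *)

Section rates.
Context {R : realType}.
Variables (g L s : R) (mu : R -> R) (b K : R).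
Hypotheses (g_gt0 : 0 < g) (s_gt0 : 0 < s) (b_gt0 : 0 < b) (K_ge1 : 1 <= K).
Local Notation k0 := (strict_floor g).
Hypothesis bumpK : forall i, (i <= k0.+2)%N ->
  (forall t, `|bump k0.+2 i t| <= K) /\
  (forall t u : R, `|bump k0.+2 i t - bump k0.+2 i u| <= K * `|t - u|).
Hypothesis bL : 3 * gauss_variance * (b * (1 + 2 * K)) ^+ 2 <= L.
Local Notation v := (@gauss_variance R).

Let v_gt0 : 0 < v. Proof. exact: gauss_variance_gt0. Qed.

Let K_ge0 : 0 <= K. Proof. exact: le_trans ler01 K_ge1. Qed.

Let vb_gt0 : 0 < v * b ^+ 2. Proof. by rewrite mulr_gt0// exprn_gt0. Qed.

(** A single alternative, in an empty bin: the shift of the errors vanishes. *)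
Lemma discretization_risk_ge (n p : nat) (x : 'I_p -> R) : (0 < n)%N -> (0 < p)%N ->
  ((v * b ^+ 2 * 2^-1 `^ g / 8)%:E <=
     minimax_risk g L s (p%:R `^ (- g)) n mu x)%E.
Proof.
move=> n0 p0; have p0' : 0 < p%:R :> R by rewrite ltr0n.
have q0 : 0 < p.+1%:R^-1 :> R by rewrite invr_gt0 ltr0n.
have [k kempty] := empty_bin x (ltn0Sn p) (ltnSn p).
set a := p%:R `^ (- g); have a0 : 0 < a by rewrite powR_gt0.
have C22 : 2 <= 2 :> R by [].
have dl : 0 <= (p.+1%:R^-1 : R) `^ g <= p.+1%:R^-1 `^ g by rewrite powR_ge0 lexx.
have S0 : (0 < #|[set k]%SET|)%N by rewrite cards1.
have Sm l : l \in [set k]%SET -> (bin_count x l)%:R <= 0 :> R.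
  by rewrite inE => /eqP ->; rewrite kempty.
apply: le_trans (bump_risk_ge mu g_gt0 s_gt0 b_gt0 K_ge1 bumpK bL n0
  (ltn0Sn p) S0 Sm dl a0 C22 _); last first.
  by rewrite cards1 !mulr0 mul0r expR0 divr1.
rewrite lee_fin.
have -> : a^-1 * (v * b ^+ 2 * p.+1%:R^-1 `^ g) / (4 * 2) =
  v * b ^+ 2 * (p%:R * p.+1%:R^-1) `^ g / (4 * 2).
  by rewrite /a powRN invrK powRM ?ltW//; ring.
rewrite (_ : 8 = 4 * 2); last by ring.
rewrite ler_wpM2r ?invr_ge0// ler_wpM2l ?(ltW vb_gt0)//.
apply: ge0_ler_powR; rewrite ?nnegrE ?mulr_ge0 ?(ltW g_gt0) ?(ltW q0)//.
rewrite ler_pdivlMr ?ltr0n//.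
have : 1 <= p%:R :> R by rewrite ler1n.
by rewrite -[p.+1%:R]natr1; lra.
Qed.

Lemma parametric_risk_ge (n p : nat) (x : 'I_p -> R) : (0 < n)%N ->
  ((v * b ^+ 2 / 24)%:E <= minimax_risk g L s (n%:R `^ (- 2^-1)) n mu x)%E.
Proof.
move=> n0; have n0' : 0 < n%:R :> R by rewrite ltr0n.
have a0 : 0 < n%:R `^ (- 2^-1) :> R by rewrite powR_gt0.
apply: le_trans (scale_risk_ge s mu g_gt0 b_gt0 K_ge1 bL x n0 a0).
rewrite lee_fin powRN invrK (powR12_sqrt (ltW n0')) /scale_factor le_eqVlt.
apply/orP; left; apply/eqP; field.
by rewrite gt_eqF// sqrtr_gt0.
Qed.

Let eta : R := (2 * g + 1)^-1.
Let Q : R := 4 * v * b ^+ 2 * K ^+ 2 / s ^+ 2.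
(** Chosen so that Q * log_amplitude ^+ 2 <= eta / 2: the exponent V of the
    second moment is then at most (eta / 2) * log(n p), while the number of bins
    is of order (n p / log(n p)) `^ eta. *)
Definition log_amplitude : R := Num.sqrt (eta / (2 * (Q + 1))).

Let eta_gt0 : 0 < eta. Proof. by rewrite invr_gt0; have := g_gt0; lra. Qed.

Let Q_ge0 : 0 <= Q.
Proof. by rewrite divr_ge0 ?sqr_ge0// !mulr_ge0 ?sqr_ge0// ltW. Qed.

Lemma log_amplitude_gt0 : 0 < log_amplitude.
Proof. by rewrite sqrtr_gt0 divr_gt0// mulr_gt0// ltr_wpDl. Qed.

Let eta_le1 : eta <= 1.
Proof. by rewrite invf_le1; have := g_gt0; lra. Qed.

Let log_amplitude_sqr : log_amplitude ^+ 2 = eta / (2 * (Q + 1)).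
Proof. by rewrite sqr_sqrtr// divr_ge0 ?(ltW eta_gt0)// mulr_ge0// addr_ge0. Qed.

Lemma ln_le_sqrt (y : R) : 0 < y -> ln y <= 2 * Num.sqrt y.
Proof.
move=> y0; rewrite -{1}(sqr_sqrtr (ltW y0)) lnXn ?sqrtr_gt0//.
rewrite -[leLHS]mulr_natl ler_wpM2l// ltW// ln_sublinear// sqrtr_gt0//.
Qed.

(** With t = log(n p) / (n p) and h of order t^eta, the second moment of the
    mixture is at most 1 + 2 t^eta (n p)^(eta / 2), which is bounded since
    log y <= 2 sqrt y. *)
Lemma log_risk_ge (n p : nat) (x : 'I_p -> R) : (1 < n)%N -> (0 < p)%N ->
  ((v * b ^+ 2 * log_amplitude * 2^-1 `^ g / 20)%:E <= minimax_risk g L s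
     ((ln (n * p)%:R / (n * p)%:R) `^ (g / (2 * g + 1))) n mu x)%E.
Proof.
move=> n1 p0; have n0 : (0 < n)%N by exact: ltnW.
set y : R := (n * p)%:R.
have y1 : 1 < y by rewrite ltr1n (leq_trans n1)// leq_pmulr.
have y0 : 0 < y by apply: lt_trans y1.
have l0 : 0 < ln y by rewrite ln_gt0.
set t := ln y / y.
have t0 : 0 < t by rewrite divr_gt0.
have t1 : t <= 1 by rewrite ler_pdivrMr// mul1r ltW// ln_sublinear.
pose h0 := t `^ eta.
have h0_gt0 : 0 < h0 by rewrite powR_gt0.
have h0_le1 : h0 <= 1.
  have : t `^ eta <= 1 `^ eta by rewrite ge0_ler_powR ?nnegrE ?(ltW eta_gt0) ?(ltW t0).
  by rewrite powR1.
have -> : t `^ (g / (2 * g + 1)) = h0 `^ g by rewrite /h0 -powRrM mulrC.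
(* the bins have width h = 1 / M between h0 / 2 and h0 *)
pose M := (Num.truncn h0^-1).+1.
have hV : 1 <= h0^-1 by rewrite invf_ge1.
have M0 : 0 < M%:R :> R by rewrite ltr0n.
have hM : M%:R^-1 <= h0.
  by rewrite -[leRHS]invrK lef_pV2 ?posrE ?invr_gt0// ltW// truncnS_gt.
have Mh : 2^-1 * h0 <= M%:R^-1.
  rewrite -[h0]invrK -invfM lef_pV2 ?posrE ?mulr_gt0 ?invr_gt0//.
  have := truncn_le h0^-1; rewrite invr_ge0 (ltW h0_gt0) => trle.
  by rewrite /M -natr1; lra.
set h := M%:R^-1 in hM Mh *.
have h_gt0 : 0 < h by rewrite invr_gt0.
pose S := [set k : 'I_M | (bin_count x k * M <= 2 * p)%N]%SET.
have MS := many_light_bins x (ltn0Sn (Num.truncn h0^-1)); rewrite -/M -/S in MS.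
have S0 : (0 < #|S|)%N by case: posnP MS => // ->; rewrite muln0.
have S0' : 0 < #|S|%:R :> R by rewrite ltr0n.
have Sm k : k \in S -> (bin_count x k)%:R <= 2 * p%:R * h.
  by rewrite inE => kS; rewrite /h ler_pdivlMr// -!natrM ler_nat.
have c0 := log_amplitude_gt0; set c := log_amplitude in c0 *.
have c1 : c <= 1.
  rewrite -(@ler_pXn2r _ 2)// ?nnegrE ?(ltW c0)// expr1n log_amplitude_sqr.
  rewrite ler_pdivrMr ?mul1r; last by rewrite mulr_gt0// ltr_wpDl.
  by apply: (le_trans eta_le1); have := Q_ge0; lra.
have dlh : 0 <= c * h `^ g <= h `^ g.
  by rewrite mulr_ge0 ?(ltW c0) ?powR_ge0//= ler_piMl// powR_ge0.
have a0 : 0 < h0 `^ g by rewrite powR_gt0.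
have C25 : 2 <= 5 :> R by lra.
apply: le_trans (bump_risk_ge mu g_gt0 s_gt0 b_gt0 K_ge1 bumpK bL n0
  (ltn0Sn _) S0 Sm dlh a0 C25 _).
- rewrite lee_fin.
  have hg : 2^-1 `^ g * h0 `^ g <= h `^ g.
    rewrite -powRM ?(ltW h0_gt0)// ge0_ler_powR ?nnegrE ?(ltW g_gt0) ?(ltW h_gt0)//.
    by rewrite mulr_ge0// ltW.
  have -> : (h0 `^ g)^-1 * (v * b ^+ 2 * (c * h `^ g)) / (4 * 5) =
     v * b ^+ 2 * c * (h `^ g / h0 `^ g) / (4 * 5) by ring.
  rewrite (_ : 20 = 4 * 5); last by ring.
  rewrite ler_wpM2r ?invr_ge0// (ler_wpM2l (mulr_ge0 (ltW vb_gt0) (ltW c0)))//.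
  by rewrite ler_pdivlMr.
(* h0 is chosen such that h0^(2 g + 1) = t *)
have hpow : h `^ g ^+ 2 * h <= t.
  have -> : t = h0 `^ (2 * g + 1).
    by rewrite /h0 -powRrM mulVf ?powRr1 ?(ltW t0)// gt_eqF//; have := g_gt0; lra.
  have -> : h `^ g ^+ 2 * h = h `^ (2 * g + 1).
    rewrite powRD; last by rewrite (gt_eqF h_gt0) implybT.
    by rewrite powRr1 ?(ltW h_gt0)// [2 * g]mulrC powRrM powR_mulrn// powR_ge0.
  rewrite ge0_ler_powR ?nnegrE ?(ltW h_gt0) ?(ltW h0_gt0)//.
  by have := g_gt0; lra.
have V_le : 2 * n%:R * v * ((b * (c * h `^ g) * K) ^+ 2 * (2 * p%:R * h)) / s ^+ 2 <=
    eta / 2 * ln y.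
  have -> : 2 * n%:R * v * ((b * (c * h `^ g) * K) ^+ 2 * (2 * p%:R * h)) / s ^+ 2 =
      (Q * c ^+ 2) * (y * (h `^ g ^+ 2 * h)).
    by rewrite /Q /y natrM; ring.
  apply: ler_pM.
  - exact: mulr_ge0 Q_ge0 (sqr_ge0 c).
  - exact: mulr_ge0 (ltW y0) (mulr_ge0 (sqr_ge0 _) (ltW h_gt0)).
  - rewrite log_amplitude_sqr mulrCA ler_wpM2l ?(ltW eta_gt0)//.
    rewrite ler_pdivrMr ?mulr_gt0 ?ltr_wpDl// mulrA mulVf// mul1r.
    by rewrite lerDl.
  - apply: (@le_trans _ _ (y * t)); first by rewrite ler_wpM2l// ltW.
    by rewrite /t mulrC divfK// gt_eqF.
have ratio : expR (eta / 2 * ln y) / #|S|%:R <= 4.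
  have SV : #|S|%:R^-1 <= 2 * h0.
    apply: (@le_trans _ _ (2 * h)); last by rewrite ler_wpM2l.
    rewrite -[2]invrK -invfM lef_pV2 ?posrE ?mulr_gt0// ?invr_gt0//.
    by rewrite ler_pdivrMl// -natrM ler_nat.
  have -> : expR (eta / 2 * ln y) = Num.sqrt y `^ eta.
    by rewrite -powR12_sqrt ?(ltW y0)// -powRrM /powR (gt_eqF y0) [2^-1 * _]mulrC.
  apply: (@le_trans _ _ (Num.sqrt y `^ eta * (2 * h0))).
    by rewrite ler_wpM2l// powR_ge0.
  rewrite mulrCA /h0 -powRM ?sqrtr_ge0 ?(ltW t0)//.
  have -> : (4:R) = 2 * 2 by ring.
  rewrite ler_wpM2l//.
  have st : Num.sqrt y * t <= 2.
    rewrite /t mulrA ler_pdivrMr// mulrC.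
    rewrite -{3}(sqr_sqrtr (ltW y0)) expr2 mulrA ler_wpM2r ?sqrtr_ge0//.
    exact: ln_le_sqrt.
  apply: (@le_trans _ _ (2 `^ eta)).
    by rewrite ge0_ler_powR ?nnegrE ?(ltW eta_gt0)// mulr_ge0 ?sqrtr_ge0// ltW.
  by apply: ler1_powR => //; lra.
apply: (@le_trans _ _ (1 + 4)); last by lra.
rewrite lerD2l; apply: le_trans ratio.
by rewrite ler_wpM2r ?invr_ge0 ?ler0n// ler_expR.
Qed.

End rates.

Theorem theorem2 (R : realType) (g L sigma0 : R) (mu : R -> R)
    (x : forall n p : nat, 'I_p -> R)
    (g_gt0 : 0 < g) (L_gt0 : 0 < L) (sigma0_gt0 : 0 < sigma0)
    (x_design : forall n p : nat, is_design (x n p)) :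
  (0 < limf_einf
         (fun np : nat * nat =>
            minimax_risk g L sigma0 (rate g np.1 np.2) np.1 mu
              (x np.1 np.2))
         (filter_prod \oo \oo))%E.
Proof.
have [K K1 bumpK] := bump_bounded (R := R) (strict_floor g).+2.
have v0 := @gauss_variance_gt0 R; set v := gauss_variance in v0.
have K2 : 0 < 1 + 2 * K by apply: ltr_wpDr; rewrite ?mulr_ge0// (le_trans ler01).
(* b turns the bound of bump_profile_holder into L *)
pose b := Num.sqrt (L / (3 * v)) / (1 + 2 * K).
have b0 : 0 < b by rewrite divr_gt0// sqrtr_gt0 divr_gt0// mulr_gt0.
have bL : 3 * v * (b * (1 + 2 * K)) ^+ 2 <= L.
  rewrite divfK ?gt_eqF// sqr_sqrtr; last by rewrite divr_ge0 ?(ltW L_gt0)// mulr_ge0// ltW.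
  by rewrite mulrC divfK// gt_eqF// mulr_gt0.
pose c1 : R := v * b ^+ 2 * 2^-1 `^ g / 8.
pose c2 : R := v * b ^+ 2 / 24.
pose c3 : R := v * b ^+ 2 * log_amplitude g sigma0 b K * 2^-1 `^ g / 20.
have vb : 0 < v * b ^+ 2 by rewrite mulr_gt0// exprn_gt0.
have g2 : 0 < 2^-1 `^ g :> R by rewrite powR_gt0 ?invr_gt0.
have c10 : 0 < c1 by rewrite divr_gt0// mulr_gt0.
have c20 : 0 < c2 by rewrite divr_gt0.
have c30 : 0 < c3.
  by rewrite divr_gt0// mulr_gt0// mulr_gt0// log_amplitude_gt0.
pose c := Num.min c1 (Num.min c3 c2).
have c0 : (0 < c%:E)%E by rewrite lte_fin !lt_min c10 c30.
rewrite limf_einfE; apply: (lt_le_trans c0); apply: le_ereal_sup_tmp.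
pose V := [set m | (1 < m)%N] `*` [set m | (1 < m)%N].
exists (ereal_inf ((fun np : nat * nat =>
  minimax_risk g L sigma0 (rate g np.1 np.2) np.1 mu (x np.1 np.2)) @` V)).
  exists V => //; exists ([set m | (1 < m)%N], [set m | (1 < m)%N]) => //=.
  by split; exists 2%N.
apply: le_ereal_inf_tmp => _ [[n p] [/= n1 p1] <-].
have n0 := ltnW n1; have p0 := ltnW p1.
rewrite /rate !maxEle; case: ifPn => _; last first.
  apply: le_trans (discretization_risk_ge mu g_gt0 sigma0_gt0 b0 K1 bumpK bL _ n0 p0).
  by rewrite lee_fin ge_min lexx.
case: ifPn => _.
  apply: le_trans (parametric_risk_ge sigma0 mu g_gt0 b0 K1 bL _ n0).
  by rewrite lee_fin !ge_min lexx !orbT.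
apply: le_trans (log_risk_ge mu g_gt0 sigma0_gt0 b0 K1 bumpK bL _ n1 p0).
by rewrite lee_fin !ge_min lexx !orbT.
Qed.
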